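(* Let $\phi:[0,1]\to[0,1]$ be given by $\phi(0)=1$ and $\phi(x)=x\log x-x+1$ for $x\in(0,1]$ (so $\phi$ is continuous and strictly decreasing from $1$ to $0$, and $\phi^{-1}:[0,1]\to[0,1]$ denotes its inverse). For $a\in(0,1/4)$ and $B\in[0,\phi^{-1}(4a)]$ let $$W(a,B):=\frac{\big(\phi(B)-\sqrt{\phi(B)^2-4a\,\phi(B)}\big)^2}{4\phi(B)}+a\,\frac{\phi(\min\{1,2B\})}{\phi(B)},$$ and define $K(a):=\min_{B\in[0,\phi^{-1}(4a)]}W(a,B)$ for $a\in(0,1/4)$. Then for every $a\in(0,1/4)$ we have $\psi(a)\le K(a)$. Moreover, $K(a)<a$ for all $a\in(0,0.11717]$, and $K(a)\le \frac{2a^2}{1-\log 2}+o(a^2)$ as $a\to0^+$.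
   Context: For $A\subseteq\mathbb N$ and $x\ge1$, let $\operatorname{R}_x(A):=1-\frac{\#(A\cap[1,x])}{x}$, and let $A\cdot A:=\{a_1a_2: a_1,a_2\in A\}$. For $a>0$ define $$\psi(a):=\sup\Big\{b\in\mathbb R_{>0}\ \Big|\ \operatorname{R}_x(A\cdot A)\ll(\log x)^{-b}\text{ for every } A\subseteq\mathbb N \text{ such that } \operatorname{R}_x(A)\ll(\log x)^{-a}\Big\},$$ where the implicit constants in $\ll$ may depend on $A$ (and $b$), and the bounds are meant for all sufficiently large $x$. *)

(* Defs.v *)
From HB Require Import structures.
From mathcomp Require Import all_boot all_order all_algebra.
From mathcomp Require Import finmap.
From mathcomp Require Import all_classical all_reals all_analysis.
From mathcomp Require Import ring lra.

Set Implicit Arguments.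
Unset Strict Implicit.
Unset Printing Implicit Defensive.

Import Order.TTheory GRing.Theory Num.Theory.
Import numFieldNormedType.Exports.

Local Open Scope classical_set_scope.
Local Open Scope ring_scope.

(* [nat] contains 0, but 0 never contributes to the counts below, neither from
   A nor from A.A. *)
Definition count_upto (R : realType) (A : set nat) (x : R) : nat :=
  #|` fset_set (A `&` [set n : nat | 1 <= (n%:R : R) <= x])|.

Lemma finite_upto (R : realType) (A : set nat) (x : R) :
  finite_set (A `&` [set n : nat | 1 <= (n%:R : R) <= x]).
Proof.
apply: (@sub_finite_set _ _ `I_((Num.truncn x).+1)); last exact: finite_II.
move=> n /= [_ /andP[n1 nx]].
have x0 : 0 <= x by apply: le_trans nx.
by rewrite ltnS truncn_ge_nat.
Qed.

Definition rel_compl (R : realType) (A : set nat) (x : R) : R :=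
  1 - (count_upto A x)%:R / x.

Definition prodset (A : set nat) : set nat :=
  [set (a1 * a2)%N | a1 in A & a2 in A].

(* R_x(A) << (log x)^-c as x -> +oo; the constant may depend on A and c. *)
Definition compl_ll (R : realType) (A : set nat) (c : R) : Prop :=
  exists C : R, \forall x \near +oo, `|rel_compl A x| <= C * ln x `^ (- c).

(* The supremum is taken in the extended reals, so that it does not rely on the
   set of exponents being bounded or nonempty. *)
Definition psi (R : realType) (a : R) : \bar R :=
  ereal_sup (EFin @` [set b : R | 0 < b /\
    forall A : set nat, compl_ll A a -> compl_ll (prodset A) b]).

Definition phi (R : realType) (x : R) : R :=
  if x == 0 then 1 else x * ln x - x + 1.

Lemma phiE (R : realType) (x : R) : phi x = x * ln x - x + 1.
Proof. by rewrite /phi; case: eqVneq => // ->; lra. Qed.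

Lemma phi0 (R : realType) : phi (0 : R) = 1. Proof. by rewrite /phi eqxx. Qed.

Lemma phi1 (R : realType) : phi (1 : R) = 0. Proof. by rewrite phiE ln1; lra. Qed.

Lemma phi_decr (R : realType) : {in `[0, 1] &, {homo @phi R : x y /~ x < y}}.
Proof.
have tangent (x y : R) : 0 < x -> 0 < y -> (x - y) * ln y <= phi x - phi y.
  move=> x0 y0; rewrite !phiE.
  have : ln (1 + (y / x - 1)) <= y / x - 1.
    by apply: le_ln1Dx; have := divr_gt0 y0 x0; lra.
  rewrite addrC subrK ln_div// -(ler_pM2l x0) !mulrBr mulrCA divff ?gt_eqF//.
  by lra.
have lt1 (x y : R) : 0 <= x -> x < y -> y < 1 -> phi y < phi x.
  move=> x0 xy y1; have y0 : 0 < y by lra.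
  have lny : ln y < 0 by apply: ln_lt0; rewrite y0.
  move: x0; rewrite le_eqVlt => /predU1P[<-|x0].
    by rewrite phi0 phiE; have := nmulr_llt0 y lny; rewrite y0; lra.
  have := tangent _ _ x0 y0; have : 0 < (x - y) * ln y by rewrite nmulr_lgt0//; lra.
  lra.
move=> y x; rewrite !in_itv/= => /andP[y0 y1] /andP[x0 x1] xy.
move: y1 xy; rewrite le_eqVlt => /predU1P[->|y1] xy; last exact: lt1.
have z0 : 0 < (x + 1) / 2 by lra.
have z1 : (x + 1) / 2 < 1 by lra.
apply: le_lt_trans (lt1 x ((x + 1) / 2) _ _ _); [|lra..].
have := tangent _ _ z0 (@ltr01 R); rewrite ln1; lra.
Qed.

Lemma xlnx_cvg0 (R : realType) : x * ln x @[x --> (0 : R)] --> (0 : R).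
Proof.
have csqrt (c : R) : c * Num.sqrt y @[y --> (0 : R)] --> (0 : R).
  rewrite -[X in _ --> X](_ : c * Num.sqrt 0 = 0); last by rewrite sqrtr0 mulr0.
  by apply: cvgM; [exact: cvg_cst|exact: (@sqrt_continuous R 0)].
apply: squeeze_cvgr (csqrt (-2)) (csqrt 2).
near=> y; rewrite mulNr -ler_norml.
have [y0|y0] := leP y 0.
  by rewrite ln0// mulr0 normr0 mulr_ge0// sqrtr_ge0.
have s0 : 0 < Num.sqrt y by rewrite sqrtr_gt0.
have ys : y = Num.sqrt y ^+ 2 by rewrite sqr_sqrtr ?ltW.
have s1 : Num.sqrt y < 1.
  by rewrite -[ltRHS]sqrtr1 ltr_sqrt//; near: y; exact: lt_nbhsl.
rewrite [in X in X <= _]ys; move: (Num.sqrt y) s0 s1 => s s0 s1.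
have lns : ln s < 0 by apply: ln_lt0; rewrite s0.
have : ln s^-1 < s^-1 by apply: ln_sublinear; rewrite invr_gt0.
rewrite lnV// -(ltr_pM2l s0) mulrN divff ?gt_eqF// => h.
rewrite lnXn// normrM ger0_norm ?sqr_ge0// ler0_norm; last by lra.
by nra.
Unshelve. all: by end_near. Qed.

Lemma continuous_phi (R : realType) : continuous (@phi R).
Proof.
have -> : @phi R = fun x => x * ln x - x + 1 by apply/funext => x; exact: phiE.
move=> x; apply: cvgD; last exact: cvg_cst.
apply: cvgB; last exact: cvg_id.
have [x0|x0|->] := ltrgtP x 0.
- rewrite (@ln0 _ x) ?ltW// mulr0; apply: cvg_near_cst.
  near=> y; rewrite ln0 ?mulr0//; apply/ltW; near: y; exact: lt_nbhsl.
- by apply: cvgM; [exact: cvg_id|exact: continuous_ln].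
- by rewrite mul0r; exact: xlnx_cvg0.
Unshelve. all: by end_near. Qed.

Lemma phi_bij (R : realType) : set_bij `[0, 1] `[0, 1] (@phi R).
Proof.
have mono : {in `[0, 1] &, {mono @phi R : x y /~ x <= y}}.
  exact/le_nmono_in/phi_decr.
have i0 : (0 : R) \in `[0, 1] by rewrite in_itv/= lexx ler01.
have i1 : (1 : R) \in `[0, 1] by rewrite in_itv/= lexx ler01.
split.
- move=> x /= xI; rewrite in_itv/= -(phi0 R) -{1}(phi1 R) !mono//.
  by move: xI; rewrite in_itv/= andbC.
- move=> x y /set_mem xI /set_mem yI xy; apply/eqP.
  by rewrite eq_le -(mono _ _ xI yI) -(mono _ _ yI xI) xy lexx.
- move=> y /= yI.
  have [||x xI <-] := @IVT R (@phi R) 0 1 y ler01.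
  + exact/continuous_subspaceT/continuous_phi.
  + by move: yI; rewrite in_itv/= phi0 phi1 min_r ?max_l.
  + by exists x.
Qed.

Definition phi_inv (R : realType) : R -> R := 'pinv_(fun=> 0) `[0, 1] (@phi R).

Lemma phi_inv_itv (R : realType) (y : R) : y \in `[0, 1] -> phi_inv y \in `[0, 1].
Proof.
by move=> yI; have [+ _ _] := bijpinv_bij (fun=> 0) (@phi_bij R); apply.
Qed.

Lemma phi_invK (R : realType) (y : R) : y \in `[0, 1] -> phi (phi_inv y) = y.
Proof.
move=> yI; have [_ _ s] := @phi_bij R.
by apply: (surjpK _ s); rewrite inE.
Qed.

Lemma phiK (R : realType) (x : R) : x \in `[0, 1] -> phi_inv (phi x) = x.
Proof.
move=> xI; have [_ i _] := @phi_bij R.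
by apply: (pinvKV _ i); rewrite inE.
Qed.

Definition W (R : realType) (a B : R) : R :=
  (phi B - Num.sqrt (phi B ^+ 2 - 4 * a * phi B)) ^+ 2 / (4 * phi B)
  + a * (phi (Num.min 1 (2 * B)) / phi B).

(* This infimum is attained: see K_min. *)
Definition K (R : realType) (a : R) : R :=
  inf (W a @` `[0, phi_inv (4 * a)]).

Lemma K_min (R : realType) (a : R) : 0 < a < 1 / 4 ->
  (exists2 B, B \in `[0, phi_inv (4 * a)] & K a = W a B) /\
  forall B : R, B \in `[0, phi_inv (4 * a)] -> K a <= W a B.
Proof.
move=> a14; have I4a : 4 * a \in `[0, 1] by rewrite in_itv/=; lra.
have := phi_inv_itv I4a; rewrite in_itv/= => /andP[b0 b1].
have [|B BI Bmin] := @EVT_min R (W a) 0 (phi_inv (4 * a)) b0.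
  apply: continuous_in_subspaceT => B /set_mem /=.
  rewrite in_itv/= => /andP[B0 Bb].
  have phiB : phi B != 0.
    have : 4 * a <= phi B; last by move=> ?; rewrite gt_eqF//; lra.
    rewrite -(phi_invK I4a) (le_nmono_in (@phi_decr R))// in_itv/= ?b0//.
    by rewrite B0 (le_trans Bb).
  have cphi : phi y @[y --> B] --> phi B by exact: continuous_phi.
  have cmin : phi (Num.min 1 (2 * y)) @[y --> B] --> phi (Num.min 1 (2 * B)).
    apply: (@continuous_comp _ _ _ (fun y : R => Num.min 1 (2 * y)) (@phi R));
      last exact: continuous_phi.
    apply: (@continuous_min R _ (fun=> 1) (fun y : R => 2 * y)).
      exact: cvg_cst.
    by apply: cvgM; [exact: cvg_cst|exact: cvg_id].
  apply: cvgD; last first.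
    by apply: cvgM; [exact: cvg_cst|apply: cvgM => //; exact: cvgV].
  apply: cvgM; last first.
    by apply: cvgV; [rewrite mulf_neq0|apply: cvgM => //; exact: cvg_cst].
  apply: (@continuous_comp _ _ _
    (fun y : R => phi y - Num.sqrt (phi y ^+ 2 - 4 * a * phi y))
    (fun z : R => z ^+ 2));
    last exact: exprn_continuous.
  apply: cvgB => //.
  apply: (@continuous_comp _ _ _ (fun y : R => phi y ^+ 2 - 4 * a * phi y)
    (@Num.sqrt R));
    last exact: sqrt_continuous.
  apply: cvgB; first by rewrite expr2; exact: cvgM.
  by apply: cvgM => //; exact: cvg_cst.
have lbB : lbound (W a @` `[0, phi_inv (4 * a)]) (W a B).
  by move=> _ [y yI <-]; exact: Bmin.
have KB : K a = W a B.
  apply/eqP; rewrite eq_le; apply/andP; split.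
    by apply: ge_inf; [exists (W a B)|exists B].
  by apply: lb_le_inf => //; exists (W a B); exists B.
by split; [exists B|move=> y yI; rewrite KB Bmin].
Qed.

(* Main.v *)
Require Import Defs.
From HB Require Import structures.
From mathcomp Require Import all_boot all_order all_algebra.
From mathcomp Require Import finmap.
From mathcomp Require Import all_classical all_reals all_analysis.
From mathcomp Require Import ring lra zify.

Set Implicit Arguments.
Unset Strict Implicit.
Unset Printing Implicit Defensive.

Import Order.TTheory GRing.Theory Num.Theory.
Import numFieldNormedType.Exports.

Local Open Scope classical_set_scope.
Local Open Scope ring_scope.

(* Let A omit, along a very sparse sequence of scales x, the integers m with ln ln m between w x and
   (1 + eps) x that have at most B w x prime factors p with ln ln p <= w x, and omit also every m
   all of whose prime factors satisfy ln p > (ln m)^a.  Suppose that n has no prime factor with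
   ln ln p <= a w x, at most 2 B w x of them with ln ln p <= w x, and ln ln n <= (1 + eps) x.  If
   n = u v, then one of u, v has at most B w x prime factors with ln ln p <= w x; that factor is
   omitted for this reason if its ln ln exceeds w x, and otherwise because its prime factors are
   all too large.  So n is not in A.A.

   The omitted sets have density O((ln N)^-a) as soon as phi(B) w > a: Rankin's trick and the
   Hall-Tenenbaum inequality reduce this to Mertens' estimates.  The integers n above are counted
   from below through the Dirichlet series of their indicator function at 1 + exp(-x), where Euler
   products replace a lower-bound sieve.  As w decreases to a / phi(B), the exponent of their
   density tends to (a / phi(B)) (a + (1 - a) phi(min(1, 2 B))), which is at most W(a, B). *)

(** * Elementary inequalities *)

Section elementary.
Context {R : realType}.
Implicit Types (s x y c t L : R) (n N : nat).

Lemma le_ln_sub1 x : 0 < x -> ln x <= x - 1.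
Proof. by move=> x0; rewrite -{1}(subrK 1 x) addrC le_ln1Dx//; lra. Qed.

Lemma ln2_le1 : ln (2 : R) <= 1.
Proof. by have := @le_ln_sub1 2; lra. Qed.

Lemma ln_le_half x : 0 < x -> ln x <= x / 2.
Proof.
move=> x0; have := @le_ln_sub1 (x / 2); rewrite ln_div ?posrE//.
by have := ln2_le1; have := divr_gt0 x0 (ltr0Sn R 1); lra.
Qed.

Lemma expR_ge1 x : 0 <= x -> 1 <= expR x.
Proof. by move=> x0; rewrite -expR0 ler_expR. Qed.

Lemma powRN_ge_tangent x t : 0 < x -> 0 <= t -> 1 - t * (x - 1) <= x `^ (- t).
Proof.
move=> x0 t0; rewrite /powR gt_eqF//.
have := expR_ge1Dx (- t * ln x).
have := ler_wpM2l t0 (le_ln_sub1 x0); lra.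
Qed.

Lemma powR1B c x : 0 < x -> x `^ (1 - c) = x * x `^ (- c).
Proof.
by move=> x0; rewrite powRD ?powRr1 ?ltW//; apply/implyP => _; rewrite gt_eqF.
Qed.

Lemma powR1B_sub_le_tangent s x y : 0 < x -> 0 < y -> 1 <= s ->
  x `^ (1 - s) - y `^ (1 - s) <= (s - 1) * (y - x) * x `^ (- s).
Proof.
move=> x0 y0 s1; have s'0 : 0 <= s - 1 by rewrite subr_ge0.
have := ler_wpM2r (powR_ge0 x (1 - s)) (powRN_ge_tangent (divr_gt0 y0 x0) s'0).
rewrite opprB -powRM ?divr_ge0 ?(ltW x0) ?(ltW y0)// divfK ?gt_eqF//.
rewrite !(powR1B _ x0).
have -> : (1 - (s - 1) * (y / x - 1)) * (x * x `^ (- s)) =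
    x * x `^ (- s) - (s - 1) * (y - x) * x `^ (- s) by field; rewrite gt_eqF.
lra.
Qed.

Lemma powR_le_tangent x c : 0 <= x -> 0 < c < 1 -> x `^ c <= 1 + c * (x - 1).
Proof.
move=> x0 /andP[c0 c1]; have c'0 : 0 < 1 - c by rewrite subr_gt0.
have := @conjugate_powR R (x `^ c) 1 c^-1 (1 - c)^-1 (powR_ge0 _ _) ler01.
rewrite !invr_gt0 !invrK powR1 -powRrM divff ?gt_eqF// powRr1//.
by move=> /(_ c0 c'0 ltac:(lra)); lra.
Qed.

Lemma powR1B_sub_ge_tangent c x y : 0 < c < 1 -> 0 <= x -> 0 < y ->
  (1 - c) * (y - x) * y `^ (- c) <= y `^ (1 - c) - x `^ (1 - c).
Proof.
move=> /andP[c0 c1] x0 y0.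
have := @powR_le_tangent (x / y) (1 - c) (divr_ge0 x0 (ltW y0)).
rewrite subr_gt0 c1 gtrBl c0 => /(_ isT) /(ler_wpM2r (powR_ge0 y (1 - c))).
rewrite -powRM ?divr_ge0 ?(ltW y0)// divfK ?gt_eqF//.
rewrite !(powR1B _ y0).
have -> : (1 + (1 - c) * (x / y - 1)) * (y * y `^ (- c)) =
    y * y `^ (- c) - (1 - c) * (y - x) * y `^ (- c) by field; rewrite gt_eqF.
lra.
Qed.

Lemma powRN_half_le x c : 0 <= x -> 0 <= c <= 1 -> (x / 2) `^ (- c) <= 2 * x `^ (- c).
Proof.
move=> x0 /andP[c0 c1].
rewrite powRM ?invr_ge0// mulrC ler_wpM2r ?powR_ge0//.
rewrite -powR_inv1// -powRrM mulN1r opprK -[leRHS]powRr1//.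
by rewrite ler_powR ?ler1n.
Qed.

Lemma invr_le_powRN x c : 1 <= x -> c <= 1 -> x^-1 <= x `^ (- c).
Proof.
by move=> x1 c1; rewrite -powR_inv1 ?ler_powR ?lerN2// (le_trans ler01).
Qed.

Lemma ler_prod_seq (I : eqType) (s : seq I) (E F : I -> R) :
  {in s, forall i, 0 <= E i <= F i} -> \prod_(i <- s) E i <= \prod_(i <- s) F i.
Proof. by move=> EF; rewrite !big_seq; exact: ler_prod. Qed.

Lemma ler_sum_seq (I : eqType) (s : seq I) (E F : I -> R) :
  {in s, forall i, E i <= F i} -> \sum_(i <- s) E i <= \sum_(i <- s) F i.
Proof. by move=> EF; rewrite !big_seq; exact: ler_sum. Qed.

Definition floor_expR L : nat := Num.truncn (expR L).

Lemma leq_floor_expR L n : (0 < n)%N -> (n <= floor_expR L)%N = (ln n%:R <= L).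
Proof.
move=> n0; rewrite truncn_ge_nat ?expR_ge0//.
by rewrite -[in RHS](expRK L) ler_ln ?posrE ?expR_gt0 ?ltr0n.
Qed.

Lemma floor_expR_gt0 L : 0 <= L -> (0 < floor_expR L)%N.
Proof. by rewrite leq_floor_expR// ln1. Qed.

Lemma ln_floor_expR_le L : 0 <= L -> ln (floor_expR L)%:R <= L.
Proof. by move=> L0; rewrite -leq_floor_expR ?floor_expR_gt0. Qed.

Lemma floor_expR_lt_ln L n : (floor_expR L < n)%N -> L < ln n%:R.
Proof.
move=> Ln; have n0 : (0 < n)%N by exact: leq_ltn_trans Ln.
by rewrite ltNge -leq_floor_expR// -ltnNge.
Qed.

Lemma near_ln_natr_ge c : \forall N \near \oo, c <= ln (N%:R : R).
Proof.
by near=> N; apply/ltW/floor_expR_lt_ln; near: N; exact: nbhs_infty_gt.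
Unshelve. all: by end_near. Qed.

End elementary.

(** * Chebyshev bounds and mean values *)

Lemma bin_leq_exp2 n m : ('C(n, m) <= 2 ^ n)%N.
Proof.
elim: n m => [|n IH] [|m]; rewrite ?bin0 ?expn_gt0//.
by rewrite binS expnS mul2n -addnn leq_add.
Qed.

Section divisor_sums.
Context {V : nmodType}.
Implicit Types (F : nat -> V) (d m n N : nat).

Lemma sum_multiples F d N : (0 < d)%N ->
  \sum_(1 <= m < N.+1 | (d %| m)%N) F m = \sum_(1 <= l < (N %/ d).+1) F (d * l)%N.
Proof.
move=> d0; rewrite -big_filter -(big_map (muln d) predT F); apply: perm_big.
apply: uniq_perm.
- by rewrite filter_uniq// iota_uniq.
- by rewrite map_inj_uniq ?iota_uniq// => x y /eqP; rewrite eqn_pmul2l// => /eqP.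
move=> m; rewrite mem_filter mem_index_iota; apply/idP/mapP.
  case/andP=> /dvdnP[l ->]; rewrite muln_gt0 => /andP[/andP[l0 _] lN].
  exists l; last by rewrite mulnC.
  by rewrite mem_index_iota l0 ltnS leq_divRL.
case=> l; rewrite mem_index_iota => /andP[l0]; rewrite ltnS leq_divRL// => lN ->.
by rewrite dvdn_mulr// muln_gt0 d0 l0/= ltnS mulnC.
Qed.

Lemma sum_divisors F m N : (0 < m <= N)%N ->
  \sum_(d <- divisors m) F d = \sum_(1 <= d < N.+1 | (d %| m)%N) F d.
Proof.
move=> /andP[m0 mN]; rewrite -[RHS]big_filter; apply/perm_big/uniq_perm.
- exact: divisors_uniq.
- by rewrite filter_uniq// iota_uniq.
move=> d; rewrite -dvdn_divisors// mem_filter mem_index_iota ltnS.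
case: (boolP (d %| m)%N) => //= dm.
by rewrite (dvdn_gt0 m0 dm) (leq_trans (dvdn_leq m0 dm)).
Qed.

Lemma exchange_hyperbola (F : nat -> nat -> V) N :
  \sum_(1 <= d < N.+1) \sum_(1 <= l < (N %/ d).+1) F d l =
  \sum_(1 <= l < N.+1) \sum_(1 <= d < (N %/ l).+1) F d l.
Proof.
have restrict (G : nat -> V) k : (0 < k)%N ->
    \sum_(1 <= l < (N %/ k).+1) G l = \sum_(1 <= l < N.+1 | (k * l <= N)%N) G l.
  move=> k0; rewrite (big_nat_widen _ _ N.+1) ?ltnS ?leq_div//.
  by apply: eq_bigl => l; rewrite ltnS leq_divRL// mulnC.
under eq_big_nat => d /andP[d0 _] do rewrite restrict// big_mkcond.
rewrite exchange_big_nat; apply: eq_big_nat => l /andP[l0 _].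
by rewrite restrict// [RHS]big_mkcond; apply: eq_bigr => d _; rewrite mulnC.
Qed.

End divisor_sums.

Section vonMangoldt.
Context {R : realType}.
Implicit Types (d m n p N : nat).

(* [primes d] is a singleton exactly when [d] is a prime power greater than 1. *)
Definition vonMangoldt d : R := if primes d is [:: p] then ln p%:R else 0.

Lemma vonMangoldt_ge0 d : 0 <= vonMangoldt d.
Proof.
rewrite /vonMangoldt; case pE: (primes d) => [|p [|]]//.
have : p \in primes d by rewrite pE inE.
by rewrite mem_primes => /andP[/prime_gt0 p0 _]; rewrite ln_ge0// ler1n.
Qed.

Lemma vonMangoldt_prime p : prime p -> vonMangoldt p = ln p%:R.
Proof. by move=> ppr; rewrite /vonMangoldt primes_prime. Qed.

Lemma ln_prime_decomp m : (0 < m)%N ->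
  ln (m%:R : R) = \sum_(p <- primes m) (logn p m)%:R * ln p%:R.
Proof.
move=> m0; rewrite -[RHS]expRK expR_sum; congr ln.
rewrite [in LHS](prod_prime_decomp m0) prime_decompE big_map natr_prod.
rewrite !big_seq; apply: eq_bigr => p; rewrite mem_primes => /andP[ppr _].
by rewrite natrX expRM_natl lnK// posrE ltr0n prime_gt0.
Qed.

Lemma count_prime_power_divisors p m : prime p -> (0 < m)%N ->
  count (fun d => primes d == [:: p]) (divisors m) = logn p m.
Proof.
move=> ppr m0; rewrite -size_filter -[RHS](size_iota 1) -[RHS](size_map (expn p)).
apply/perm_size/uniq_perm; first by rewrite filter_uniq ?divisors_uniq.
  by rewrite map_inj_in_uniq ?iota_uniq// => i j _ _; exact: expnI (prime_gt1 ppr) i j.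
move=> d; rewrite mem_filter -dvdn_divisors//.
apply/andP/mapP => [[/eqP dE dm]|[j]].
  have d0 := dvdn_gt0 m0 dm; exists (logn p d); last first.
    by rewrite [LHS](prod_prime_decomp d0) prime_decompE dE big_seq1.
  by rewrite mem_iota add1n ltnS dvdn_leq_log// andbT logn_gt0 dE inE eqxx.
rewrite mem_iota add1n ltnS => /andP[j0 jm] ->.
by rewrite primesX// primes_prime// eqxx pfactor_dvdn.
Qed.

Lemma sum_vonMangoldt_divisors m : (0 < m)%N ->
  \sum_(d <- divisors m) vonMangoldt d = ln m%:R.
Proof.
move=> m0; have vonMangoldtE d : (d %| m)%N ->
    vonMangoldt d = \sum_(p <- primes m | primes d == [:: p]) ln p%:R.
  move=> dm; rewrite /vonMangoldt; case dE: (primes d) => [|p [|q s]].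
  - by rewrite big_pred0.
  - have pm : p \in primes m.
      have : p \in primes d by rewrite dE inE.
      by rewrite !mem_primes m0 => /and3P[-> _ /dvdn_trans->].
    rewrite big_mkcond (bigD1_seq p) ?primes_uniq//= eqxx big1 ?addr0// => q qp.
    by rewrite eqseq_cons andbT eq_sym (negbTE qp).
  - by rewrite big_pred0// => p'; rewrite eqseq_cons andbF.
rewrite big_seq; under eq_bigr => d.
  rewrite -dvdn_divisors// => /vonMangoldtE ->; over.
rewrite -big_seq (exchange_big_dep predT)//= ln_prime_decomp//.
rewrite !big_seq; apply: eq_bigr => p; rewrite mem_primes => /andP[ppr _].
by rewrite big_const_seq iter_addr addr0 count_prime_power_divisors// mulr_natl.
Qed.

Lemma ln_fact N n : (n <= N)%N ->
  ln (n`!%:R : R) = \sum_(1 <= d < N.+1) vonMangoldt d * (n %/ d)%:R.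
Proof.
move=> nN; have -> : ln (n`!%:R : R) = \sum_(1 <= m < n.+1) ln m%:R.
  elim: n {nN} => [|n IH]; first by rewrite fact0 ln1 big_geq.
  by rewrite factS mulnC natrM lnM ?posrE ?ltr0n ?fact_gt0// IH [RHS]big_nat_recr.
under eq_big_nat => m /andP[m0 mn].
  rewrite -sum_vonMangoldt_divisors// (@sum_divisors _ _ _ N) ?m0 ?(leq_trans _ nN)//.
  rewrite big_mkcond; over.
rewrite exchange_big_nat; apply: eq_big_nat => d /andP[d0 _].
by rewrite -big_mkcond sum_multiples// sumr_const_nat subn1 mulr_natr.
Qed.

Lemma ln_fact_half n : ln (n`!%:R : R) - 2 * ln ((n./2)`!%:R : R) <= 2 * n%:R.
Proof.
set m := n./2.
have factR_gt0 k : 0 < (k`!%:R : R) by rewrite ltr0n fact_gt0.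
have mn : (m <= n)%N by rewrite /m; lia.
have : (n`! <= 2 ^ n * (m`! * (m`! * m.+1)))%N.
  rewrite -(bin_fact mn) leq_mul ?bin_leq_exp2// leq_mul2l; apply/orP; right.
  have : (n - m == m)%N || (n - m == m.+1)%N by rewrite /m; lia.
  by case/orP=> /eqP ->; [rewrite leq_pmulr|rewrite factS mulnC].
rewrite -(ler_nat R) !natrM natrX -ler_ln ?posrE ?factR_gt0//.
rewrite !lnM ?posrE ?mulr_gt0 ?factR_gt0 ?exprn_gt0 ?ltr0n// lnXn//.
have lnm : ln (m.+1%:R : R) <= n%:R.
  apply: le_trans (le_ln_sub1 _) _; rewrite ?ltr0n//.
  by rewrite -natr1 addrK ler_nat.
have : ln 2 *+ n <= n%:R :> R by rewrite -[leLHS]mulr_natl ler_piMr// ln2_le1.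
lra.
Qed.

Lemma sum_vonMangoldt_upper_half_le n :
  \sum_(n./2.+1 <= d < n.+1) vonMangoldt d <= 2 * n%:R.
Proof.
have half_le : (n./2 <= n)%N by lia.
apply: le_trans (ln_fact_half n).
rewrite (@ln_fact n n)// (@ln_fact n n./2)// mulr_sumr -sumrB.
have combine d : vonMangoldt d * (n %/ d)%:R - 2 * (vonMangoldt d * (n./2 %/ d)%:R) =
    vonMangoldt d * (n %/ d - 2 * (n./2 %/ d))%:R.
  rewrite natrB ?natrM; first by ring.
  have [->|d0] := posnP d; first by rewrite !divn0.
  rewrite leq_divRL//; apply: leq_trans (_ : n./2 * 2 <= n)%N; last by lia.
  by rewrite -mulnA mulnC leq_mul2r leq_trunc_div orbT.
under [leRHS]eq_bigr do rewrite combine.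
rewrite [leRHS](big_cat_nat _ (n := n./2.+1))//=; apply: ler_wpDl.
  by apply: sumr_ge0 => d _; rewrite mulr_ge0 ?vonMangoldt_ge0.
apply: ler_sum_nat => d /andP[d1 d2].
rewrite ler_peMr ?vonMangoldt_ge0// ler1n (@divn_small n./2)// muln0 subn0.
by rewrite divn_gt0//; lia.
Qed.

Lemma sum_vonMangoldt_le n : \sum_(1 <= d < n.+1) vonMangoldt d <= 4 * n%:R.
Proof.
elim/ltn_ind: n => n IH.
have [->|n0] := posnP n; first by rewrite big_geq// mulr0.
have half_lt : (n./2 < n)%N by lia.
rewrite (big_cat_nat _ (n := n./2.+1))//=; last exact: ltnW.
have := IH _ half_lt; have := sum_vonMangoldt_upper_half_le n.
have : 2 * (n./2%:R : R) <= n%:R by rewrite -natrM ler_nat; lia.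
lra.
Qed.

Lemma sum_ln_prime_div_le n : (0 < n)%N ->
  \sum_(1 <= p < n.+1 | prime p) ln (p%:R : R) / p%:R <= ln n%:R + 4.
Proof.
move=> n0; have n0R : 0 < (n%:R : R) by rewrite ltr0n.
apply: (@le_trans _ _ (\sum_(1 <= d < n.+1) vonMangoldt d / d%:R)).
  rewrite big_mkcond/=; apply: ler_sum => p _; case: ifPn => ppr.
    by rewrite vonMangoldt_prime.
  by rewrite divr_ge0 ?vonMangoldt_ge0.
rewrite -(ler_pM2l n0R).
apply: (@le_trans _ _ (ln n`!%:R + \sum_(1 <= d < n.+1) vonMangoldt d)).
  rewrite (@ln_fact n n)// mulr_sumr -big_split/=; apply: ler_sum_nat => d /andP[d0 _].
  rewrite mulrCA -[X in _ <= _ + X]mulr1 -mulrDr ler_wpM2l ?vonMangoldt_ge0//.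
  by rewrite ler_pdivrMr ?ltr0n// natr1 -natrM ler_nat ltnW// ltn_ceil.
have : ln (n`!%:R : R) <= n%:R * ln n%:R.
  rewrite mulr_natl -lnXn// ler_ln ?posrE ?ltr0n ?fact_gt0 ?exprn_gt0//.
  rewrite -natrX ler_nat; elim: n {n0 n0R} => // n IH.
  rewrite factS expnS leq_mul2l /=; apply: leq_trans IH _.
  by case: n => // n; rewrite leq_exp2r.
by have := sum_vonMangoldt_le n; lra.
Qed.

Section mean_value.
Variables (f : nat -> R) (N : nat).
Hypothesis f_ge0 : forall m, 0 <= f m.
Hypothesis f_dvd_le : forall d l, (0 < d)%N -> (0 < l)%N -> f (d * l)%N <= f l.

Lemma sum_mul_ln_le :
  \sum_(1 <= m < N.+1) f m * ln m%:R <= 4 * N%:R * \sum_(1 <= m < N.+1) f m / m%:R.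
Proof.
under eq_big_nat => m /andP[m0 mn].
  rewrite -sum_vonMangoldt_divisors// (@sum_divisors _ _ _ N) ?m0//.
  rewrite big_mkcond mulr_sumr; over.
rewrite exchange_big_nat.
apply: (@le_trans _ _
  (\sum_(1 <= d < N.+1) \sum_(1 <= l < (N %/ d).+1) f l * vonMangoldt d)).
  apply: ler_sum_nat => d /andP[d0 _].
  under eq_bigr do rewrite (fun_if (fun x => _ * x)) mulr0.
  rewrite -big_mkcond sum_multiples//; apply: ler_sum_nat => l /andP[l0 _].
  by rewrite ler_wpM2r ?vonMangoldt_ge0 ?f_dvd_le.
rewrite exchange_hyperbola mulr_sumr; apply: ler_sum_nat => l /andP[l0 _].
rewrite -mulr_sumr mulrCA -mulrA ler_wpM2l// mulrA.
apply: le_trans (sum_vonMangoldt_le _) _; rewrite -mulrA ler_wpM2l//.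
by rewrite ler_pdivlMr ?ltr0n// -natrM ler_nat leq_trunc_div.
Qed.

(* Hall--Tenenbaum: write [ln N = ln m + ln (N / m)] and bound [ln (N / m)] by [N / m]. *)
Lemma dvd_le_mean_le :
  ln N%:R * \sum_(1 <= m < N.+1) f m <= 5 * N%:R * \sum_(1 <= m < N.+1) f m / m%:R.
Proof.
have : \sum_(1 <= m < N.+1) f m * (ln N%:R - ln m%:R) <=
    N%:R * \sum_(1 <= m < N.+1) f m / m%:R.
  rewrite mulr_sumr; apply: ler_sum_nat => m /andP[m0 mN].
  have N0 : (0 < N)%N by lia.
  rewrite mulrCA ler_wpM2l// -ln_div ?posrE ?ltr0n// ltW// ln_sublinear//.
  by rewrite divr_gt0 ?ltr0n.
have -> : \sum_(1 <= m < N.+1) f m * (ln N%:R - ln m%:R) =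
    ln N%:R * \sum_(1 <= m < N.+1) f m - \sum_(1 <= m < N.+1) f m * ln m%:R.
  by rewrite mulr_sumr -sumrB; apply: eq_bigr => m _; ring.
have := sum_mul_ln_le; lra.
Qed.

End mean_value.
End vonMangoldt.

(** * Dirichlet series and Euler products *)

Section zeta_sums.
Context {R : realType}.
Implicit Types (s : R) (n N : nat).

Lemma natr_powRN_le_inv s n : 1 <= s -> (0 < n)%N -> n%:R `^ (- s) <= (n%:R : R)^-1.
Proof. by move=> s1 n0; rewrite -powR_inv1// ler_powR ?ler1n// lerN2. Qed.

Lemma natr_powRN_le_half s n : 1 <= s -> (1 < n)%N -> n%:R `^ (- s) <= 2^-1 :> R.
Proof.
move=> s1 n1; apply: le_trans (natr_powRN_le_inv s1 (ltnW n1)) _.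
by rewrite lef_pV2 ?posrE ?ltr0n ?ler_nat// ltnW.
Qed.

Lemma sum_natr_powRN_le s N : 1 < s ->
  \sum_(1 <= n < N.+1) n%:R `^ (- s) <= 1 + (s - 1)^-1 :> R.
Proof.
move=> s1; have s'0 : 0 < s - 1 by rewrite subr_gt0.
case: N => [|N]; first by rewrite big_geq// addr_ge0// invr_ge0 ltW.
rewrite big_ltn// powR1 lerD2l -(ler_pM2l s'0) divff ?gt_eqF// big_add1/= mulr_sumr.
apply: le_trans (_ : \sum_(1 <= n < N.+1) (- n.+1%:R `^ (1 - s) - - n%:R `^ (1 - s)) <= _).
  apply: ler_sum_nat => n /andP[n0 _].
  have := @powR1B_sub_le_tangent R s n.+1%:R n%:R; rewrite !ltr0n => /(_ isT n0 (ltW s1)).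
  by rewrite -natr1; lra.
by rewrite telescope_sumr// powR1 opprK addrC gerBl powR_ge0.
Qed.

Lemma sum_natr_powRN_ge s N : 1 < s -> 1 <= (s - 1) * ln (N.+1%:R : R) ->
  (2 * (s - 1))^-1 <= \sum_(1 <= n < N.+1) n%:R `^ (- s) :> R.
Proof.
move=> s1 sN; have s'0 : 0 < s - 1 by rewrite subr_gt0.
rewrite invfM ler_pdivrMr// mulrC mulr_sumr.
apply: le_trans (_ : \sum_(1 <= n < N.+1) (- n.+1%:R `^ (1 - s) - - n%:R `^ (1 - s)) <= _);
    last first.
  apply: ler_sum_nat => n /andP[n0 _].
  have := @powR1B_sub_le_tangent R s n%:R n.+1%:R; rewrite !ltr0n => /(_ n0 isT (ltW s1)).
  by rewrite -natr1; lra.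
rewrite telescope_sumr// powR1 opprK -opprB powRN /powR pnatr_eq0/=.
have : (expR ((s - 1) * ln N.+1%:R))^-1 <= 2^-1.
  rewrite lef_pV2 ?posrE ?expR_gt0//.
  by have := expR_ge1Dx ((s - 1) * ln (N.+1%:R : R)); lra.
lra.
Qed.

End zeta_sums.

Section dirichlet_series.
Context {R : realType}.
Implicit Types (s c : R) (f g : nat -> R) (d m n p N : nat).

Definition unit_valued f : Prop := forall n, 0 <= f n <= 1.

Lemma unit_valued_bool (b : pred nat) : unit_valued (fun n => (b n)%:R).
Proof. by move=> n; case: (b n); rewrite lexx ler01. Qed.

Lemma unit_valued_restrict (b : pred nat) f :
  unit_valued f -> unit_valued (fun n => (b n)%:R * f n).
Proof. by move=> f01 n; case: (b n); rewrite ?mul1r ?mul0r// lexx ler01. Qed.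

Lemma unit_valued_expr c (k : nat -> nat) :
  0 <= c <= 1 -> unit_valued (fun n => c ^+ k n).
Proof. by move=> /andP[c0 c1] n; rewrite exprn_ge0//= exprn_ile1. Qed.

Lemma unit_valued1 : unit_valued (fun=> 1).
Proof. by move=> n; rewrite ler01 lexx. Qed.

Definition dirichlet_term s f : R ^nat := fun n => f n * n%:R `^ (- s).

Definition dirichlet_cvg s f : Prop := cvgn (series (dirichlet_term s f)).

Definition dirichlet s f : R := limn (series (dirichlet_term s f)).

Definition zeta s : R := dirichlet s (fun=> 1).

Lemma dirichletD s f g : dirichlet_cvg s f -> dirichlet_cvg s g ->
  dirichlet s (fun n => f n + g n) = dirichlet s f + dirichlet s g.
Proof.
move=> cf cg; rewrite -lim_seriesD//; congr (limn (series _)).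
by apply/funext => n; exact: mulrDl.
Qed.

Lemma dirichlet_cvgZ s c f : dirichlet_cvg s f -> dirichlet_cvg s (fun n => c * f n).
Proof.
move=> cf; rewrite /dirichlet_cvg (_ : dirichlet_term _ _ = c *: dirichlet_term s f).
  exact: is_cvg_seriesZ.
by apply/funext => n; rewrite /dirichlet_term -mulrA.
Qed.

Lemma dirichletZ s c f : dirichlet_cvg s f ->
  dirichlet s (fun n => c * f n) = c * dirichlet s f.
Proof.
move=> cf; rewrite -[RHS]lim_seriesZ//; congr (limn (series _)).
by apply/funext => n; rewrite /dirichlet_term -mulrA.
Qed.

Lemma cvg_dirichlet_sum s (I : Type) (r : seq I) (f : I -> nat -> R) :
  (forall i, dirichlet_cvg s (f i)) ->
  series (dirichlet_term s (fun n => \sum_(i <- r) f i n)) @ \oo -->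
  \sum_(i <- r) dirichlet s (f i).
Proof.
move=> cf; rewrite (_ : series _ = fun N => \sum_(i <- r) series (dirichlet_term s (f i)) N).
  by apply: cvg_big => [|i _]; [exact: add_continuous|exact: cf].
apply/funext => N; rewrite /series/= exchange_big/=.
by apply: eq_bigr => n _; rewrite /dirichlet_term mulr_suml.
Qed.

Section half_line.
Variable s : R.
Hypothesis s1 : 1 < s.

Let s_neq0 : - s != 0. Proof. by rewrite oppr_eq0 gt_eqF// (lt_trans ltr01). Qed.

Let term0 f : dirichlet_term s f 0 = 0.
Proof. by rewrite /dirichlet_term (powR0 s_neq0) mulr0. Qed.

Let series1 f N : series (dirichlet_term s f) N.+1 =
  \sum_(1 <= n < N.+1) f n * n%:R `^ (- s).
Proof. by rewrite /series/= big_ltn// term0 add0r. Qed.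

Lemma eq_dirichlet f g : (forall n, (0 < n)%N -> f n = g n) ->
  dirichlet s f = dirichlet s g.
Proof.
move=> fg; congr (limn (series _)); apply/funext => -[|n]; first by rewrite !term0.
by rewrite /dirichlet_term fg.
Qed.

Lemma ler_dirichlet f g : dirichlet_cvg s f -> dirichlet_cvg s g ->
  (forall n, (0 < n)%N -> f n <= g n) -> dirichlet s f <= dirichlet s g.
Proof.
move=> cf cg fg; apply: lim_series_le => // -[|n]; first by rewrite !term0.
by rewrite /dirichlet_term ler_wpM2r ?powR_ge0 ?fg.
Qed.

Let term_ge0 f n : (forall n, 0 <= f n) -> 0 <= dirichlet_term s f n.
Proof. by move=> f0; rewrite mulr_ge0 ?powR_ge0. Qed.

Lemma dirichlet_cvg_zeta : dirichlet_cvg s (fun=> 1).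
Proof.
apply: nondecreasing_is_cvgn.
  by apply: nondecreasing_series => n _ _; exact: term_ge0.
exists (1 + (s - 1)^-1) => _ [N _ <-].
case: N => [|N]; first by rewrite /series/= big_geq// addr_ge0// invr_ge0 subr_ge0 ltW.
by rewrite series1; under eq_bigr do rewrite mul1r; exact: sum_natr_powRN_le.
Qed.

Lemma dirichlet_cvg_unit f : unit_valued f -> dirichlet_cvg s f.
Proof.
move=> f01; have f0 n : 0 <= f n by have /andP[] := f01 n.
apply: series_le_cvg dirichlet_cvg_zeta => n; [exact: term_ge0|exact: term_ge0|].
by rewrite ler_wpM2r ?powR_ge0//; have /andP[] := f01 n.
Qed.

Lemma sum_le_dirichlet f N : unit_valued f ->
  \sum_(1 <= n < N.+1) f n * n%:R `^ (- s) <= dirichlet s f.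
Proof.
move=> f01; rewrite -series1; apply: nondecreasing_cvgn_le; last exact: dirichlet_cvg_unit.
apply: nondecreasing_series => n _ _; apply: term_ge0 => m.
by have /andP[] := f01 m.
Qed.

Lemma dirichlet_le f c : unit_valued f ->
  (forall N, \sum_(1 <= n < N.+1) f n * n%:R `^ (- s) <= c) -> dirichlet s f <= c.
Proof.
move=> f01 fc; apply: limr_le; first exact: dirichlet_cvg_unit.
near=> N; have <- : N.-1.+1 = N by rewrite prednK//; near: N; exact: nbhs_infty_gt.
by rewrite series1 fc.
Unshelve. all: by end_near. Qed.

Lemma dirichlet_ge0 f : unit_valued f -> 0 <= dirichlet s f.
Proof. by move=> /(sum_le_dirichlet 0); rewrite big_geq. Qed.

Lemma dirichlet_ge_head f : unit_valued f -> f 1%N <= dirichlet s f.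
Proof. by move=> /(sum_le_dirichlet 1); rewrite big_nat1 powR1 mulr1. Qed.

Lemma zeta_ge0 : 0 <= zeta s.
Proof. exact/dirichlet_ge0/unit_valued1. Qed.

Lemma zeta_le : zeta s <= 1 + (s - 1)^-1.
Proof.
apply: dirichlet_le unit_valued1 _ => N.
by under eq_bigr do rewrite mul1r; exact: sum_natr_powRN_le.
Qed.

Lemma dirichlet_dilate f p : unit_valued f -> (0 < p)%N ->
  dirichlet s (fun n => (p %| n)%:R * f n) =
  p%:R `^ (- s) * dirichlet s (fun n => f (p * n)%N).
Proof.
move=> f01 p0; have ps0 : 0 < p%:R `^ (- s) :> R by rewrite powR_gt0// ltr0n.
have pf01 := unit_valued_restrict (dvdn p) f01.
have partial N : \sum_(1 <= n < N.+1) (p %| n)%:R * f n * n%:R `^ (- s) =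
    p%:R `^ (- s) * \sum_(1 <= l < (N %/ p).+1) f (p * l)%N * l%:R `^ (- s).
  transitivity (\sum_(1 <= n < N.+1 | (p %| n)%N) f n * n%:R `^ (- s)).
    by rewrite [RHS]big_mkcond; apply: eq_bigr => n _; case: ifP; rewrite ?mul1r ?mul0r.
  rewrite sum_multiples// mulr_sumr; apply: eq_bigr => l _.
  by rewrite natrM powRM// mulrCA.
apply/le_anti/andP; split.
  apply: dirichlet_le pf01 _ => N; rewrite partial ler_pM2l//.
  by apply: sum_le_dirichlet => n; exact: f01.
rewrite mulrC -ler_pdivlMr//; apply: dirichlet_le => [n|N]; first exact: f01.
rewrite ler_pdivlMr// mulrC -{1}(mulKn N p0) -partial.
exact: sum_le_dirichlet pf01.
Qed.

Lemma dirichlet_remove_euler_factor f c p : unit_valued f -> (0 < p)%N ->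
  (forall m, (0 < m)%N -> f (p * m)%N = c * f m) ->
  dirichlet s (fun n => (~~ (p %| n)%N)%:R * f n) = (1 - c * p%:R `^ (- s)) * dirichlet s f.
Proof.
move=> f01 p0 fp.
have cvg_restrict (b : pred nat) : dirichlet_cvg s (fun n => (b n)%:R * f n).
  exact/dirichlet_cvg_unit/unit_valued_restrict.
have := dirichletD (cvg_restrict (fun n => ~~ (p %| n)%N)) (cvg_restrict (dvdn p)).
rewrite dirichlet_dilate// (eq_dirichlet fp) dirichletZ; last exact: dirichlet_cvg_unit.
rewrite (_ : dirichlet s (fun n => _ + _) = dirichlet s f).
  by move=> split_p; rewrite mulrBl mul1r {1}split_p; ring.
by apply: eq_dirichlet => n _; rewrite -mulrDl; case: (p %| n)%N;
  rewrite ?addr0 ?add0r mul1r.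
Qed.

End half_line.
End dirichlet_series.

Definition bigomega (Q : seq nat) n := (\sum_(p <- Q) logn p n)%N.

Definition smooth (Q : seq nat) n := all (mem Q) (primes n).

Section bigomega.
Implicit Types (Q P : seq nat) (m n p : nat).

Lemma bigomegaM Q m n : (0 < m)%N -> (0 < n)%N ->
  bigomega Q (m * n) = (bigomega Q m + bigomega Q n)%N.
Proof. by move=> m0 n0; rewrite -big_split; apply: eq_bigr => p _; exact: lognM. Qed.

Lemma bigomega1 Q : bigomega Q 1 = 0%N.
Proof. by rewrite /bigomega big1// => p _; exact: logn1. Qed.

Lemma bigomega_prime Q p : prime p -> uniq Q -> bigomega Q p = (p \in Q).
Proof.
move=> ppr uQ; rewrite -count_uniq_mem// -sum1_count [RHS]big_mkcond.
by apply: eq_bigr => q _; rewrite logn_prime//=; case: eqP.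
Qed.

Lemma bigomega_cons Q p n : bigomega (p :: Q) n = (logn p n + bigomega Q n)%N.
Proof. by rewrite /bigomega big_cons. Qed.

Lemma bigomega_cat Q P n : bigomega (Q ++ P) n = (bigomega Q n + bigomega P n)%N.
Proof. by rewrite /bigomega big_cat. Qed.

Lemma perm_bigomega Q P n : perm_eq Q P -> bigomega Q n = bigomega P n.
Proof. exact: perm_big. Qed.

Lemma bigomega_eq0P Q n : all prime Q -> (0 < n)%N ->
  reflect {in Q, forall p, ~~ (p %| n)%N} (bigomega Q n == 0%N).
Proof.
move=> /allP prQ n0; rewrite /bigomega sum_nat_seq_eq0.
apply: (iffP allP) => h p pQ; have := h p pQ; have ppr := prQ p pQ.
  by rewrite lognE ppr n0/=; case: (p %| n)%N.
by move=> pn; rewrite lognE (negbTE pn) !andbF.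
Qed.

Lemma smooth_primeM Q p m : prime p -> (0 < m)%N ->
  smooth Q (p * m) = (p \in Q) && smooth Q m.
Proof.
move=> ppr m0.
have pm q : (q \in primes (p * m)) = (q == p) || (q \in primes m).
  by rewrite (primesM _ (prime_gt0 ppr) m0) (primes_prime ppr) inE.
apply/allP/andP => [h|[pQ /allP h] q]; last by rewrite pm => /predU1P[->|/h].
by split; [apply: h; rewrite pm eqxx|apply/allP => q qm; apply: h; rewrite pm qm orbT].
Qed.

Lemma smooth_cons_coprime Q p n : ~~ (p %| n)%N -> smooth (p :: Q) n = smooth Q n.
Proof.
move=> pn; apply: eq_in_all => q; rewrite mem_primes /= inE => /and3P[_ _ qn].
by case: eqVneq qn => // ->; rewrite (negbTE pn).
Qed.

Lemma smooth_nil n : (1 < n)%N -> smooth [::] n = false.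
Proof.
move=> n1; apply/negbTE/allPn; exists (pdiv n) => //.
by rewrite mem_primes pdiv_prime// pdiv_dvd (ltnW n1).
Qed.

End bigomega.

Section euler_products.
Context {R : realType}.
Implicit Types (B : R) (Q P Z : seq nat) (k n p : nat).

Variable s : R.
Hypothesis s1 : 1 < s.

Lemma dirichlet_expr_bigomega B Q : 0 <= B <= 1 -> all prime Q -> uniq Q ->
  dirichlet s (fun n => B ^+ bigomega Q n) * \prod_(p <- Q) (1 - B * p%:R `^ (- s)) =
  zeta s * \prod_(p <- Q) (1 - p%:R `^ (- s)).
Proof.
move=> B01; have pow01 Q' := unit_valued_expr (bigomega Q') B01.
elim: Q => [|p Q IH] /=.
  by move=> _ _; rewrite !big_nil !mulr1; apply: eq_dirichlet => // n _;
    rewrite /bigomega big_nil.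
move=> /andP[ppr prQ] /andP[pQ uQ]; rewrite !big_cons.
have p0 := prime_gt0 ppr; have Qp : bigomega Q p = 0%N by rewrite bigomega_prime// (negbTE pQ).
have factor_consQ := @dirichlet_remove_euler_factor R s s1 _ B p (pow01 (p :: Q)) p0.
have factor_Q := @dirichlet_remove_euler_factor R s s1 _ 1 p (pow01 Q) p0.
have factor_eq : (1 - B * p%:R `^ (- s)) * dirichlet s (fun n => B ^+ bigomega (p :: Q) n) =
    (1 - p%:R `^ (- s)) * dirichlet s (fun n => B ^+ bigomega Q n).
  rewrite -factor_consQ => [|m m0]; last first.
    by rewrite bigomegaM// bigomega_cons logn_prime// eqxx Qp exprS.
  rewrite -[p%:R `^ _]mul1r -factor_Q => [|m m0]; last by rewrite bigomegaM// Qp mul1r.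
  apply: eq_dirichlet => // n _; rewrite bigomega_cons.
  have [_|pn] := boolP (p %| n)%N; first by rewrite !mul0r.
  by rewrite lognE (negbTE pn) !andbF.
by rewrite mulrA [_ * (1 - B * _)]mulrC factor_eq -mulrA IH// mulrCA.
Qed.

Lemma dirichlet_bigomega0 Q : all prime Q -> uniq Q ->
  dirichlet s (fun n => (bigomega Q n == 0%N)%:R) =
  zeta s * \prod_(p <- Q) (1 - p%:R `^ (- s)).
Proof.
move=> prQ uQ; rewrite -(@dirichlet_expr_bigomega 0) ?lexx ?ler01//.
rewrite [X in _ * X]big1 => [|p _]; last by rewrite mul0r subr0.
by rewrite mulr1; apply: eq_dirichlet => // n _; rewrite expr0n.
Qed.

Lemma dirichlet_smooth Q : all prime Q -> uniq Q ->
  dirichlet s (fun n => (smooth Q n)%:R) * \prod_(p <- Q) (1 - p%:R `^ (- s)) = 1.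
Proof.
elim: Q => [|p Q IH] /=.
  move=> _ _; rewrite big_nil mulr1; apply/le_anti/andP; split.
    apply: dirichlet_le (unit_valued_bool _) _ => // -[|N]; first by rewrite big_geq.
    rewrite big_ltn// powR1 mulr1 big_nat_cond big1 ?addr0 ?lern1 ?leq_b1// => n.
    by move=> /andP[/andP[n1 _] _]; rewrite smooth_nil// mul0r.
  exact: le_trans (dirichlet_ge_head s1 (unit_valued_bool _)).
move=> /andP[ppr prQ] /andP[pQ uQ]; rewrite big_cons mulrCA mulrA.
rewrite -[p%:R `^ _]mul1r -dirichlet_remove_euler_factor ?prime_gt0//; first last.
- by move=> m m0; rewrite smooth_primeM// inE eqxx mul1r.
- exact: unit_valued_bool.
rewrite -[RHS](IH prQ uQ); congr (_ * _); apply: eq_dirichlet => // n n0.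
have [pn|pn] := boolP (p %| n)%N; last by rewrite smooth_cons_coprime// mul1r.
have /dvdnP[m nE] := pn; move: n0; rewrite nE mulnC muln_gt0 => /andP[_ m0].
by rewrite mul0r smooth_primeM// (negbTE pQ).
Qed.

Definition omega_class Q P k n := (bigomega Q n == 0%N) && (bigomega P n == k).

Lemma perm_omega_class Q P Z k : perm_eq (Q ++ P) Z ->
  omega_class Q P k =1 omega_class Q Z k.
Proof.
move=> QPZ n; rewrite /omega_class; case: eqP => //= Qn.
by rewrite -(perm_bigomega n QPZ) bigomega_cat Qn.
Qed.

(* Each integer of the class of [k + 1] is reached at most [k + 1] times when the integers of the
   class of [k] are multiplied by the primes of [P]. *)
Lemma dirichlet_omega_classS Q P k : all prime (Q ++ P) -> uniq (Q ++ P) ->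
  (\sum_(p <- P) p%:R `^ (- s)) * dirichlet s (fun n => (omega_class Q P k n)%:R) <=
  k.+1%:R * dirichlet s (fun n => (omega_class Q P k.+1 n)%:R).
Proof.
rewrite all_cat cat_uniq => /andP[prQ /allP prP] /and3P[uQ /hasPn QP uP].
pose h n : R := (omega_class Q P k.+1 n)%:R.
have h01 : unit_valued h by exact: unit_valued_bool.
have mult_cvg p : dirichlet_cvg s (fun n => (p %| n)%:R * h n).
  exact/dirichlet_cvg_unit/unit_valued_restrict.
have -> : (\sum_(p <- P) p%:R `^ (- s)) * dirichlet s (fun n => (omega_class Q P k n)%:R) =
    \sum_(p <- P) dirichlet s (fun n => (p %| n)%:R * h n).
  rewrite mulr_suml !big_seq; apply: eq_bigr => p pP; have ppr := prP _ pP.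
  rewrite dirichlet_dilate ?prime_gt0//; congr (_ * _); apply: eq_dirichlet => // m m0.
  rewrite /h /omega_class !(bigomegaM _ (prime_gt0 ppr) m0).
  rewrite (bigomega_prime ppr uQ) (bigomega_prime ppr uP).
  by rewrite pP (negbTE (QP _ pP)) add1n eqSS.
have sum_cvg := @cvg_dirichlet_sum _ _ _ P _ mult_cvg.
rewrite -(cvg_lim _ sum_cvg)// -dirichletZ; last exact: dirichlet_cvg_unit.
apply: ler_dirichlet => //; first exact/cvgP/sum_cvg.
  by apply: dirichlet_cvgZ; exact: dirichlet_cvg_unit.
move=> n n0; rewrite -mulr_suml /h /omega_class; case: andP => [[_ /eqP nk]|_];
  last by rewrite !mulr0.
rewrite !mulr1 -natr_sum ler_nat -nk /bigomega !big_seq; apply: leq_sum => p pP.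
by case: (boolP (p %| n)%N) => // pn; rewrite logn_gt0 mem_primes prP// n0 pn.
Qed.

Lemma dirichlet_omega_class_ge Q P k : all prime (Q ++ P) -> uniq (Q ++ P) ->
  (\sum_(p <- P) p%:R `^ (- s)) ^+ k / k`!%:R *
    (zeta s * \prod_(p <- Q ++ P) (1 - p%:R `^ (- s))) <=
  dirichlet s (fun n => (omega_class Q P k n)%:R).
Proof.
move=> prQP uQP; elim: k => [|k IH].
  rewrite expr0 fact0 divr1 mul1r -dirichlet_bigomega0// le_eqVlt; apply/predU1P; left.
  by apply: eq_dirichlet => // n _; rewrite bigomega_cat addn_eq0.
rewrite factS natrM exprS.
have sum_ge0 : 0 <= \sum_(p <- P) p%:R `^ (- s) :> R by apply: sumr_ge0 => p _; exact: powR_ge0.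
have := le_trans (ler_wpM2l sum_ge0 IH) (dirichlet_omega_classS k prQP uQP).
rewrite -ler_pdivrMl ?ltr0n//; apply: le_trans.
by rewrite le_eqVlt; apply/predU1P; left; rewrite invfM; ring.
Qed.

End euler_products.

(** * Mertens' estimates *)

Definition primes_upto N := [seq p <- index_iota 1 N.+1 | prime p].

Lemma mem_primes_upto N p : (p \in primes_upto N) = prime p && (p <= N)%N.
Proof.
rewrite mem_filter mem_index_iota ltnS; case: (boolP (prime p)) => //= ppr.
by rewrite prime_gt0.
Qed.

Lemma all_primes_upto N : all prime (primes_upto N).
Proof. exact: filter_all. Qed.

Lemma primes_upto_uniq N : uniq (primes_upto N).
Proof. by rewrite filter_uniq// iota_uniq. Qed.

Section mertens.
Context {R : realType}.
Implicit Types (s B L x d : R) (Q : seq nat) (f : nat -> R) (k m n p N : nat).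

Lemma sum_prime_sqr_inv_le N : \sum_(p <- primes_upto N) (p%:R^-1 : R) ^+ 2 <= 1.
Proof.
rewrite big_filter big_mkcond/=.
apply: (@le_trans _ _ (\sum_(1 <= n < N.+1) (if n == 1 then 0 else (n.-1%:R^-1 - n%:R^-1)))).
  apply: ler_sum_nat => -[|[|n]]// _.
  case: ifP => _; last by rewrite subr_ge0 lef_pV2 ?posrE ?ltr0n// ler_nat.
  rewrite -[n.+2%:R]natr1/=; have := ltr0Sn R n; move: n.+1%:R => x x0.
  rewrite -subr_ge0 (_ : _ - _ = (x * (x + 1) ^+ 2)^-1).
    by rewrite invr_ge0 mulr_ge0 ?sqr_ge0 ?ltW//; lra.
  by field; rewrite !gt_eqF//; lra.
case: N => [|N]; first by rewrite big_geq.
rewrite big_ltn//= add0r big_add1/=.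
rewrite (eq_big_nat _ _ (F2 := fun n => - n.+1%:R^-1 - - n%:R^-1)) => [|[|n]//]; last first.
  by rewrite opprK addrC.
by rewrite telescope_sumr// invr1 opprK addrC gerBl invr_ge0.
Qed.

Lemma expR_le_sub1 x : 0 <= x <= 2^-1 -> expR (- (x + 2 * x ^+ 2)) <= 1 - x.
Proof.
move=> /andP[x0 x2]; rewrite expRN -[leLHS]mul1r ler_pdivrMr ?expR_gt0//.
apply: le_trans (_ : (1 - x) * (1 + (x + 2 * x ^+ 2)) <= _); last first.
  by rewrite ler_wpM2l ?expR_ge1Dx//; lra.
rewrite -subr_ge0 (_ : _ - _ = x ^+ 2 * (1 - 2 * x)); last by ring.
by rewrite mulr_ge0 ?sqr_ge0//; lra.
Qed.

Lemma prod_euler_factors_ge s N : 1 <= s ->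
  expR (- (\sum_(p <- primes_upto N) p%:R `^ (- s)) - 2) <=
  \prod_(p <- primes_upto N) (1 - p%:R `^ (- s)) :> R.
Proof.
move=> s1; apply: le_trans
  (_ : expR (\sum_(p <- primes_upto N) - (p%:R `^ (- s) + 2 * (p%:R `^ (- s)) ^+ 2)) <= _).
  rewrite ler_expR sumrN -opprD lerN2 big_split/= lerD2l -mulr_sumr ler_piMr//.
  apply: le_trans (sum_prime_sqr_inv_le N); apply: ler_sum_seq => p.
  rewrite mem_primes_upto => /andP[ppr _].
  by rewrite ler_sqr ?nnegrE ?powR_ge0 ?invr_ge0// natr_powRN_le_inv// prime_gt0.
rewrite expR_sum; apply: ler_prod_seq => p; rewrite mem_primes_upto => /andP[ppr _].
by rewrite expR_ge0 expR_le_sub1// powR_ge0 natr_powRN_le_half// prime_gt1.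
Qed.

Lemma euler_factor_gt0 s B p : 1 <= s -> 0 <= B <= 1 -> prime p ->
  0 < 1 - B * p%:R `^ (- s).
Proof.
move=> s1 /andP[B0 B1] /prime_gt1 /(natr_powRN_le_half s1).
have := powR_ge0 (p%:R : R) (- s); move: (_ `^ _) => x x0 x1.
have := ler_wpM2r x0 B1; lra.
Qed.

Lemma prod_euler_factors_le s Q : 1 <= s -> all prime Q ->
  \prod_(p <- Q) (1 - p%:R `^ (- s)) <= expR (- \sum_(p <- Q) p%:R `^ (- s)) :> R.
Proof.
move=> s1 /allP prQ; rewrite -sumrN expR_sum; apply: ler_prod_seq => p /prQ ppr.
have := @euler_factor_gt0 s 1 p s1; rewrite ler01 lexx mul1r => /(_ isT ppr) /ltW -> /=.
exact: expR_ge1Dx.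
Qed.

Lemma dirichlet_smooth_ge L : 1 <= L ->
  L / 2 <= dirichlet (1 + L^-1) (fun n => (smooth (primes_upto (floor_expR L)) n)%:R).
Proof.
move=> L1; have L0 : 0 < L by lra.
have s1 : 1 < 1 + L^-1 by rewrite ltrDl invr_gt0.
have -> : L / 2 = (2 * (1 + L^-1 - 1))^-1 by rewrite addrAC subrr add0r invfM invrK mulrC.
apply: le_trans (sum_natr_powRN_ge (N := floor_expR L) s1 _) _.
  rewrite addrAC subrr add0r ler_pdivlMl// mulr1.
  exact/ltW/floor_expR_lt_ln.
apply: le_trans (sum_le_dirichlet s1 (floor_expR L) (unit_valued_bool _)).
apply: ler_sum_nat => n /andP[n0 nN].
rewrite (_ : smooth _ _) ?mul1r//; apply/allP => p.
rewrite mem_primes/= mem_primes_upto => /and3P[-> _ /(dvdn_leq n0) pn]/=.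
exact: leq_trans pn _.
Qed.

Lemma sum_prime_powRN_ge L s : 1 <= L -> 1 <= s <= 1 + L^-1 ->
  ln L - 3 <= \sum_(p <- primes_upto (floor_expR L)) p%:R `^ (- s).
Proof.
move=> L1 /andP[s1 sL]; have L0 : 0 < L by lra.
set N := floor_expR L.
have t1 : 1 < 1 + L^-1 by rewrite ltrDl invr_gt0.
apply: (@le_trans _ _ (\sum_(p <- primes_upto N) p%:R `^ (- (1 + L^-1)))); last first.
  apply: ler_sum_seq => p; rewrite mem_primes_upto => /andP[/prime_gt0 p0 _].
  by rewrite ler_powR ?ler1n// lerN2.
have := dirichlet_smooth t1 (all_primes_upto N) (primes_upto_uniq N).
have := dirichlet_smooth_ge L1; have := prod_euler_factors_ge N (ltW t1); rewrite -/N.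
move: (dirichlet _ _) (\prod_(p <- _) _) (\sum_(p <- _) _) => D P S SP LD DP.
have : L / 2 * expR (- S - 2) <= 1.
  by rewrite -[leRHS]DP ler_pM ?expR_ge0 ?divr_ge0 ?(ltW L0).
move=> /ln_le0; rewrite lnM ?posrE ?expR_gt0 ?divr_gt0// expRK ln_div ?posrE//.
have := @ln2_le1 R; lra.
Qed.

Lemma sum_powRN_le_ln_zeta s Q : 1 < s -> all prime Q -> uniq Q ->
  \sum_(p <- Q) p%:R `^ (- s) <= ln (zeta s).
Proof.
move=> s1 prQ uQ.
have zeta_exp_ge1 : 1 <= zeta s * expR (- \sum_(p <- Q) p%:R `^ (- s)).
  apply: le_trans (ler_wpM2l (zeta_ge0 s1) (prod_euler_factors_le (ltW s1) prQ)).
  rewrite -dirichlet_bigomega0//; apply: le_trans (dirichlet_ge_head s1 (unit_valued_bool _)).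
  by rewrite bigomega1.
have z0 : 0 < zeta s.
  by rewrite -(pmulr_lgt0 _ (expR_gt0 (- \sum_(p <- Q) p%:R `^ (- s)))) (lt_le_trans ltr01).
by move: (ln_ge0 zeta_exp_ge1); rewrite lnM ?posrE ?expR_gt0// expRK subr_ge0.
Qed.

Lemma zeta_le_double L : 1 <= L -> zeta (1 + L^-1) <= 2 * L.
Proof.
move=> L1; have L0 : 0 < L by lra.
apply: le_trans (zeta_le _) _; first by rewrite ltrDl invr_gt0.
by rewrite addrAC subrr add0r invrK; lra.
Qed.

Lemma natr_powRN1D d n : (0 < n)%N ->
  n%:R `^ (- (1 + d)) = n%:R^-1 * expR (- (d * ln n%:R)).
Proof.
move=> n0; have n0R : (n%:R : R) != 0 by rewrite pnatr_eq0 -lt0n.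
rewrite opprD powRD; last by apply/implyP => _.
by rewrite powR_inv1// [in X in _ * X]/powR (negbTE n0R) mulNr.
Qed.

Lemma natr_inv_sub_powRN_le d n : (0 < n)%N ->
  n%:R^-1 - n%:R `^ (- (1 + d)) <= d * (ln n%:R / n%:R).
Proof.
move=> n0; rewrite natr_powRN1D//; have := expR_ge1Dx (- (d * ln (n%:R : R))).
have : 0 <= (n%:R : R)^-1 by rewrite invr_ge0.
move: (ln _) (expR _) (n%:R^-1) => z y x x0 /(ler_wpM2l x0); lra.
Qed.

Lemma sum_prime_inv_le L : 1 <= L ->
  \sum_(p <- primes_upto (floor_expR L)) (p%:R : R)^-1 <= ln L + 6.
Proof.
move=> L1; have L0 : 0 < L by lra.
set N := floor_expR L; have s1 : 1 < 1 + L^-1 by rewrite ltrDl invr_gt0.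
have smoothed : \sum_(p <- primes_upto N) p%:R `^ (- (1 + L^-1)) <= ln L + 1.
  apply: le_trans (sum_powRN_le_ln_zeta s1 (all_primes_upto N) (primes_upto_uniq N)) _.
  have z0 : 0 < zeta (1 + L^-1).
    exact: lt_le_trans ltr01 (dirichlet_ge_head s1 unit_valued1).
  apply: le_trans (_ : ln (2 * L) <= _).
    by rewrite ler_ln ?posrE ?mulr_gt0// zeta_le_double.
  by rewrite lnM ?posrE//; have := @ln2_le1 R; lra.
suff : \sum_(p <- primes_upto N) ((p%:R : R)^-1 - p%:R `^ (- (1 + L^-1))) <= 5.
  by rewrite sumrB; lra.
apply: (@le_trans _ _ (\sum_(p <- primes_upto N) L^-1 * (ln p%:R / p%:R))).
  apply: ler_sum_seq => p; rewrite mem_primes_upto => /andP[/prime_gt0 p0 _].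
  exact: natr_inv_sub_powRN_le.
rewrite -mulr_sumr big_filter ler_pdivrMl//.
apply: le_trans (sum_ln_prime_div_le (floor_expR_gt0 (ltW L0))) _.
by have := ln_floor_expR_le (ltW L0); lra.
Qed.

Lemma dirichlet_expr_bigomega_le s B Q : 1 < s -> 0 <= B <= 1 -> all prime Q -> uniq Q ->
  dirichlet s (fun n => B ^+ bigomega Q n) <=
  zeta s * expR (- (1 - B) * \sum_(p <- Q) p%:R `^ (- s)).
Proof.
move=> s1 B01 prQ uQ; have factor_gt0 p : p \in Q -> 0 < 1 - B * p%:R `^ (- s).
  by move=> /(allP prQ); exact: euler_factor_gt0 (ltW s1) B01.
have prod_gt0 : 0 < \prod_(p <- Q) (1 - B * p%:R `^ (- s)).
  by rewrite big_seq; exact: prodr_gt0.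
rewrite -(ler_pM2r prod_gt0) dirichlet_expr_bigomega// -mulrA ler_wpM2l ?zeta_ge0//.
rewrite mulr_sumr expR_sum -big_split/=; apply: ler_prod_seq => p pQ.
have := @euler_factor_gt0 s 1 p (ltW s1); rewrite ler01 lexx mul1r.
move=> /(_ isT (allP prQ _ pQ)) /ltW -> /=.
have := factor_gt0 _ pQ; move: (p%:R `^ _) => x Bx; have /andP[B0 B1] := B01.
apply: le_trans (_ : (1 + - (1 - B) * x) * (1 - B * x) <= _); last first.
  by rewrite ler_pM2r// expR_ge1Dx.
rewrite -subr_ge0 (_ : _ - _ = B * (1 - B) * x ^+ 2); last by ring.
by rewrite mulr_ge0 ?sqr_ge0 ?mulr_ge0//; lra.
Qed.

Lemma sum_div_le_dirichlet f N : unit_valued f -> 0 < ln (N%:R : R) ->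
  \sum_(1 <= m < N.+1) f m / m%:R <= expR 1 * dirichlet (1 + (ln N%:R)^-1) f.
Proof.
move=> f01 lN; have s1 : 1 < 1 + (ln (N%:R : R))^-1 by rewrite ltrDl invr_gt0.
apply: le_trans (ler_wpM2l (expR_ge0 1) (sum_le_dirichlet s1 N f01)).
rewrite mulr_sumr; apply: ler_sum_nat => m /andP[m0 mN].
have /andP[f0 _] := f01 m; rewrite mulrCA ler_wpM2l// natr_powRN1D// mulrCA -expRD.
rewrite ler_peMr ?invr_ge0// expR_ge1// subr_ge0.
by rewrite ler_pdivrMl// mulr1 ler_ln ?posrE ?ltr0n ?ler_nat//; lia.
Qed.

Lemma count_bigomega_le B Q k N : 0 <= B <= 1 -> all prime Q -> uniq Q ->
  1 <= ln (N%:R : R) ->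
  (\sum_(1 <= m < N.+1) (bigomega Q m <= k)%N)%:R * B ^+ k <=
  10 * expR 1 * N%:R * expR (- (1 - B) * \sum_(p <- Q) p%:R `^ (- (1 + (ln N%:R)^-1))).
Proof.
move=> /andP[B0 B1] prQ uQ; set l := ln (N%:R : R) => l1; have l0 : 0 < l by lra.
have pow01 : unit_valued (fun m => B ^+ bigomega Q m) by apply: unit_valued_expr; rewrite B0.
apply: (@le_trans _ _ (\sum_(1 <= m < N.+1) B ^+ bigomega Q m)).
  rewrite natr_sum mulr_suml; apply: ler_sum => m _.
  case: leqP => mk; last by rewrite mul0r exprn_ge0.
  by rewrite mul1r; exact: ler_wiXn2l.
have mean := @dvd_le_mean_le R (fun m => B ^+ bigomega Q m) N (fun m => (andP (pow01 m)).1).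
rewrite -(ler_pM2l l0); apply: le_trans (mean _) _ => [d m d0 m0|].
  by rewrite bigomegaM// exprD ler_piMl ?exprn_ge0// exprn_ile1.
set E := expR (- _ * _).
have -> : l * (10 * expR 1 * N%:R * E) = 5 * N%:R * (expR 1 * (2 * l * E)) by ring.
rewrite ler_wpM2l ?mulr_ge0//; apply: le_trans (sum_div_le_dirichlet pow01 l0) _.
rewrite ler_wpM2l ?expR_ge0//; apply: le_trans (dirichlet_expr_bigomega_le _ _ prQ uQ) _.
- by rewrite ltrDl invr_gt0.
- by rewrite B0.
by rewrite ler_wpM2r ?expR_ge0// zeta_le_double.
Qed.

Definition loglog_primes x := primes_upto (floor_expR (expR x)).

Lemma mem_loglog_primes x p : (p \in loglog_primes x) = prime p && (ln p%:R <= expR x).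
Proof.
rewrite mem_primes_upto; case: (boolP (prime p)) => //= ppr.
by rewrite leq_floor_expR ?prime_gt0.
Qed.

Lemma all_loglog_primes x : all prime (loglog_primes x).
Proof. exact: all_primes_upto. Qed.

Lemma loglog_primes_uniq x : uniq (loglog_primes x).
Proof. exact: primes_upto_uniq. Qed.

Lemma sum_loglog_primes_ge x s : 0 <= x -> 1 <= s <= 1 + expR (- x) ->
  x - 3 <= \sum_(p <- loglog_primes x) p%:R `^ (- s).
Proof.
by move=> x0; rewrite -{2}[x]expRK expRN; apply: sum_prime_powRN_ge; exact: expR_ge1.
Qed.

Lemma sum_loglog_primes_le x s : 0 <= x -> 1 <= s ->
  \sum_(p <- loglog_primes x) p%:R `^ (- s) <= x + 6.
Proof.
move=> x0 s1; rewrite -{2}[x]expRK.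
apply: le_trans (sum_prime_inv_le (expR_ge1 x0)); apply: ler_sum_seq => p.
by rewrite mem_loglog_primes => /andP[/prime_gt0 p0 _]; exact: natr_powRN_le_inv.
Qed.

End mertens.

(** * Sparse sets of integers *)

Section card_upto.
Implicit Types (P Q : set nat) (K N : nat).

Definition card_upto P N := (\sum_(1 <= m < N.+1) `[< P m >])%N.

Lemma count_uptoE (R : realType) P (x : R) : 0 <= x ->
  count_upto P x = card_upto P (Num.truncn x).
Proof.
move=> x0; rewrite /count_upto /card_upto.
set X := _ `&` _; have finX : finite_set X by exact: finite_upto.
transitivity (size [seq m <- index_iota 1 (Num.truncn x).+1 | `[< P m >]]).
  apply: perm_size; apply: uniq_perm; rewrite ?fset_uniq ?filter_uniq ?iota_uniq// => m.
  rewrite in_fset_set// mem_filter mem_index_iota ltnS truncn_ge_nat//.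
  apply/idP/idP => [/set_mem[Pm /= /andP[m1 mx]]|/and3P[/asboolP Pm m1 mx]].
    by rewrite mx andbT asboolT//=; move: m1; rewrite ler1n.
  by apply/mem_set; split=> //=; rewrite mx ler1n m1.
by rewrite size_filter -sum1_count big_mkcond; apply: eq_bigr => m _; case: asboolP.
Qed.

Lemma card_uptoC P N : (card_upto P N + card_upto (~` P) N)%N = N.
Proof.
rewrite /card_upto -big_split/=.
rewrite (eq_bigr (fun=> 1%N)); first by rewrite sum_nat_const_nat subn1 muln1.
by move=> m _; case: asboolP => Pm; case: asboolP.
Qed.

Lemma card_upto_le P N : (card_upto P N <= N)%N.
Proof. by rewrite -[leqRHS](card_uptoC P) leq_addr. Qed.

Lemma leq_card_upto P Q N : (forall m, (0 < m <= N)%N -> P m -> Q m) ->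
  (card_upto P N <= card_upto Q N)%N.
Proof.
move=> PQ; rewrite /card_upto big_nat_cond [leqRHS]big_nat_cond.
apply: leq_sum => m /andP[mN _]; case: asboolP => // Pm.
by rewrite asboolT//; exact: PQ Pm.
Qed.

Lemma card_uptoU P Q N : (card_upto (P `|` Q) N <= card_upto P N + card_upto Q N)%N.
Proof.
rewrite /card_upto -big_split/=; apply: leq_sum => m _.
by case: asboolP => // -[] mPQ; rewrite (asboolT mPQ) ?leq_addr ?leq_addl.
Qed.

Lemma card_upto_initial K N : (card_upto [set m | (m <= K)%N] N <= K)%N.
Proof.
elim: N => [|N IH]; first by rewrite /card_upto big_geq.
have [NK|KN] := ltnP N K; first by apply: leq_trans (card_upto_le _ _) NK.
rewrite /card_upto big_nat_recr//= asboolF ?addn0//.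
by apply/negP; rewrite -ltnNge.
Qed.

End card_upto.

Section sparse.
Context {R : realType}.
Implicit Types (P Q A : set nat) (a b C : R) (N m : nat).

Definition sparse P a : Prop := exists2 C : R, 0 <= C &
  \forall N \near \oo, (card_upto P N)%:R <= C * (N%:R * ln N%:R `^ (- a)).

Lemma sparseU P Q a : sparse P a -> sparse Q a -> sparse (P `|` Q) a.
Proof.
move=> [C C0 P_le] [D D0 Q_le]; exists (C + D); first exact: addr_ge0.
near=> N; apply: (@le_trans _ _ (card_upto P N + card_upto Q N)%:R).
  by rewrite ler_nat card_uptoU.
by rewrite natrD mulrDl lerD//; near: N.
Unshelve. all: by end_near. Qed.

Lemma card_upto_le_large P N : 1 <= ln (N%:R : R) ->
  (card_upto P N)%:R <= N%:R / ln N%:R +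
    (card_upto (P `&` [set m | ln (N%:R : R) / 2 <= ln m%:R]) N)%:R :> R.
Proof.
move=> lN; have N0 : (0 < N)%N by case: N lN => //; rewrite ln0//; lra.
have N0R : 0 < (N%:R : R) by rewrite ltr0n.
set l := ln (N%:R : R) in lN *; have l0 : 0 < l by lra.
set K := Num.truncn (N%:R / l).
have : (card_upto P N <= card_upto [set m | (m <= K)%N] N +
    card_upto (P `&` [set m | (l / 2 <= ln (m%:R : R))%R]) N)%N.
  apply: leq_trans (card_uptoU _ _ _); apply: leq_card_upto => m /andP[m0 mN] Pm.
  have [mK|Km] := leqP m K; [by left|right; split => //=].
  have {}Km : N%:R / l <= m%:R by rewrite ltW// (lt_le_trans (truncnS_gt _))// ler_nat.
  have : ln (N%:R / l) <= ln m%:R by rewrite ler_ln ?posrE ?ltr0n// divr_gt0.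
  by rewrite ln_div ?posrE//; have := ln_le_half l0; rewrite -/l; lra.
rewrite -(ler_nat R) natrD => /le_trans; apply; rewrite lerD2r.
apply: (@le_trans _ _ K%:R); first by rewrite ler_nat card_upto_initial.
by rewrite truncn_le divr_ge0// ltW.
Qed.

Lemma sparse_of_large P a C : 0 <= a <= 1 -> 0 <= C ->
  (\forall N \near \oo,
    (card_upto (P `&` [set m | ln (N%:R : R) / 2 <= ln m%:R]) N)%:R <=
    C * (N%:R * (ln N%:R / 2) `^ (- a))) ->
  sparse P a.
Proof.
move=> /andP[a0 a1] C0 large; exists (1 + 2 * C); first by rewrite addr_ge0// mulr_ge0.
near=> N; have l1 : 1 <= ln (N%:R : R) by near: N; exact: near_ln_natr_ge.
rewrite mulrDl mul1r; apply: le_trans (card_upto_le_large P l1) (lerD _ _).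
  by rewrite ler_wpM2l// invr_le_powRN.
apply: (@le_trans _ _ (C * (N%:R * (ln N%:R / 2) `^ (- a)))); first by near: N.
rewrite [2 * C]mulrC -mulrA [2 * _]mulrCA !ler_wpM2l//.
by apply: powRN_half_le; [exact: le_trans l1|rewrite a0].
Unshelve. all: by end_near. Qed.

Lemma rel_complE A (x : R) (N := Num.truncn x) : 0 <= x ->
  rel_compl A x = 1 - (N%:R - (card_upto (~` A) N)%:R) / x.
Proof.
by move=> x0; rewrite /rel_compl count_uptoE// -{1}(card_uptoC A N) natrD addrK.
Qed.

Lemma sparse_setC_compl_ll A a : 0 <= a <= 1 -> sparse (~` A) a -> compl_ll A a.
Proof.
move=> /andP[a0 a1] [C C0 [N0 _ compl_le]]; exists (1 + 2 * C); near=> x.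
have xe : expR 2 <= x by near: x; exact: nbhs_pinfty_ge.
have x4 : 4 <= x by near: x; exact: nbhs_pinfty_ge.
have x0 : 0 < x by lra.
have lx : 2 <= ln x by rewrite -[leLHS]expRK ler_ln ?posrE ?expR_gt0.
set N := Num.truncn x.
have Nx : N%:R <= x by rewrite truncn_le ltW.
have xN : x < N%:R + 1 by rewrite natr1 truncnS_gt.
have lxN : ln x / 2 <= ln N%:R.
  have : ln (x / 2) <= ln N%:R by rewrite ler_ln ?posrE//; lra.
  by rewrite ln_div ?posrE//; have := @ln2_le1 R; lra.
rewrite rel_complE ?(ltW x0)// -/N; have := compl_le N; rewrite /= truncn_ge_nat ?(ltW x0)//.
have -> : N0%:R <= x by near: x; exact: nbhs_pinfty_ge.
move=> /(_ isT); have := ler0n R (card_upto (~` A) N); move: (card_upto _ _)%:R => c c0 cN.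
have -> : 1 - (N%:R - c) / x = (x - N%:R + c) / x by field; rewrite gt_eqF.
rewrite ger0_norm; last by rewrite divr_ge0 ?(ltW x0)//; lra.
rewrite ler_pdivrMr//.
have powN : ln N%:R `^ (- a) <= 2 * ln x `^ (- a).
  apply: le_trans (@powRN_half_le R (ln x) a _ _); [|lra|by rewrite a0].
  rewrite !powRN lef_pV2 ?posrE ?powR_gt0//; try lra.
  by apply: ge0_ler_powR => //; rewrite ?nnegrE; lra.
have powx : 1 <= x * ln x `^ (- a).
  rewrite -ler_pdivrMl// mulr1.
  apply: le_trans (invr_le_powRN _ a1); last by lra.
  by rewrite lef_pV2 ?posrE//; [apply/ltW/ln_sublinear|lra].
have : N%:R * ln N%:R `^ (- a) <= x * (2 * ln x `^ (- a)).
  by apply: ler_pM => //; exact: powR_ge0.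
by move=> /(ler_wpM2l C0); lra.
Unshelve. all: by end_near. Qed.

Lemma compl_ll_sparse_setC A b : compl_ll A b -> sparse (~` A) b.
Proof.
move=> [C A_ll]; exists `|C| => //; near=> N.
have N0 : (0 < N)%N by near: N; exact: nbhs_infty_gt.
have N0R : 0 < (N%:R : R) by rewrite ltr0n.
have : `|rel_compl A (N%:R : R)| <= C * ln N%:R `^ (- b).
  by near: N; exact: (@cvgr_idn R) _ A_ll.
rewrite rel_complE// natrK; move: (card_upto _ _)%:R => c /(le_trans (ler_norm _)) compl_le.
rewrite mulrCA -ler_pdivrMl//; apply: le_trans (_ : 1 - (N%:R - c) / N%:R <= _); last first.
  by apply: le_trans compl_le _; rewrite ler_wpM2r ?powR_ge0// ler_norm.
by rewrite mulrBl divff ?gt_eqF// subKr mulrC.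
Unshelve. all: by end_near. Qed.

End sparse.

(** * A set of small relative complement *)

Section construction.
Context {R : realType}.
Implicit Types (a r x B : R) (m n p k N : nat).

Lemma card_upto_bigomega_le B r N : 0 <= B <= 1 -> 0 <= r -> expR r <= ln (N%:R : R) ->
  (card_upto [set m | (bigomega (loglog_primes r) m)%:R <= B * r] N)%:R <=
  10 * expR 4 * N%:R * expR (- (phi B * r)).
Proof.
move=> /andP[B0 B1] r0 rN; have Br0 : 0 <= B * r by exact: mulr_ge0.
have l1 : 1 <= ln (N%:R : R) by apply: le_trans (expR_ge1 r0) rN.
pose K := Num.truncn (B * r).
have -> : card_upto [set m | (bigomega (loglog_primes r) m)%:R <= B * r] N =
    (\sum_(1 <= m < N.+1) (bigomega (loglog_primes r) m <= K))%N.
  by apply: eq_bigr => m _; rewrite asboolb truncn_ge_nat.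
have := @count_bigomega_le R B _ K N _ (all_loglog_primes r) (loglog_primes_uniq r) l1.
rewrite B0 B1 => /(_ isT); move: (\sum_(_ <= _ < _) _)%N => c rankin.
have exp_le_pow : expR (B * r * ln B) <= B ^+ K.
  have [B_eq0|Bn0] := eqVneq B 0; first by rewrite /K B_eq0 !mul0r expR0 truncn0 expr0.
  have Bp : 0 < B by rewrite lt_neqAle eq_sym Bn0.
  rewrite -[leRHS](lnK (exprn_gt0 _ Bp)) ler_expR lnXn// -mulr_natl.
  by rewrite ler_wnM2r ?ln_le0// truncn_le.
rewrite -(ler_pM2r (expR_gt0 (B * r * ln B))).
apply: le_trans (ler_wpM2l (ler0n _ _) exp_le_pow) _; apply: le_trans rankin _.
have := @sum_loglog_primes_ge R r (1 + (ln N%:R)^-1) r0.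
rewrite lerDl lerD2l invr_ge0 expRN lef_pV2 ?posrE ?expR_gt0 ?(lt_le_trans ltr01)//.
rewrite rN (le_trans ler01)// => /(_ isT); move: (\sum_(p <- _) _) => S Sge.
have -> : 10 * expR 4 * N%:R * expR (- (phi B * r)) * expR (B * r * ln B) =
    10 * expR 1 * N%:R * expR (3 - (1 - B) * r).
  have exp_split : expR 4 * (expR (- (phi B * r)) * expR (B * r * ln B)) =
      expR 1 * expR (3 - (1 - B) * r) by rewrite -!expRD phiE; congr expR; ring.
  by transitivity (10 * N%:R * (expR 1 * expR (3 - (1 - B) * r))); [rewrite -exp_split|]; ring.
rewrite ler_wpM2l ?mulr_ge0 ?expR_ge0// ler_expR.
have : (1 - B) * (r - 3) <= (1 - B) * S by rewrite ler_wpM2l// subr_ge0.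
lra.
Qed.

Definition rough a : set nat :=
  [set m | forall p, prime p -> (p %| m)%N -> ln (m%:R : R) `^ a < ln p%:R].

Lemma sparse_rough a : 0 < a <= 1 -> sparse (rough a) a.
Proof.
move=> /andP[a0 a1].
apply: (@sparse_of_large _ _ _ (10 * expR 4)); rewrite ?(ltW a0) ?mulr_ge0 ?expR_ge0//.
near=> N; have : 2 <= ln (N%:R : R) by near: N; exact: near_ln_natr_ge.
set l := ln (N%:R : R) => l2; have {}l2 : 1 <= l / 2 by lra.
have pow_ge1 : 1 <= (l / 2) `^ a by rewrite -[leLHS](powRr0 (l / 2)) ler_powR// ltW.
pose r := ln ((l / 2) `^ a); have rE : expR r = (l / 2) `^ a by rewrite lnK ?posrE; lra.
have rl : expR r <= l by rewrite rE; apply: le_trans (ler1_powR l2 a1) _; lra.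
have := @card_upto_bigomega_le 0 r N; rewrite lexx ler01 => /(_ isT (ln_ge0 pow_ge1) rl).
rewrite phi0 mul1r expRN rE -powRN -mulrA; apply: le_trans.
rewrite ler_nat; apply: leq_card_upto => m /andP[m0 mN] [rough_m /= lm].
rewrite mul0r lern0; apply/bigomega_eq0P => // [|p]; first exact: all_loglog_primes.
rewrite mem_loglog_primes rE => /andP[ppr pl]; apply/negP => pm.
have := rough_m _ ppr pm; rewrite ltNge => /negP; apply; apply: le_trans pl _.
by apply: ge0_ler_powR => //; rewrite ?nnegrE; lra.
Unshelve. all: by end_near. Qed.

Variables (a w eps B : R) (scale : nat -> R).

Definition prime_poor_at x : set nat :=
  [set m | [/\ expR (w * x) < ln (m%:R : R), ln (m%:R : R) <= expR ((1 + eps) * x)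
    & (bigomega (loglog_primes (w * x)) m)%:R <= B * (w * x)]].

Definition prime_poor : set nat := \bigcup_k prime_poor_at (scale k).

Definition sieved : set nat := ~` (rough a `|` prime_poor).

Hypotheses (a0 : 0 < a) (a1 : a <= 1) (w0 : 0 < w) (w1 : w <= 1) (eps0 : 0 < eps).
Hypothesis B01 : 0 <= B <= 1.
Hypothesis phiBw : (1 + eps) * a <= phi B * w.
Hypothesis scale_ge1 : forall k, 1 <= scale k.
Hypothesis scaleS : forall k, (2 + eps) * scale k <= w * scale k.+1.

Lemma ler_scale : {homo scale : k k' / (k <= k')%N >-> k <= k'}.
Proof.
apply: homo_leq => [//|y x z|k]; first exact: le_trans.
have := scaleS k; have := scale_ge1 k; have := scale_ge1 k.+1.
have := eps0; have := w1; nra.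
Qed.

(* The ranges [exp (w * x) < ln m <= exp ((1 + eps) * x)] of successive scales [x] are so far apart
   that at most one of them meets [[sqrt N, N]]. *)
Lemma prime_poor_scale_le k k' m m' N : (0 < m' <= N)%N ->
  ln (N%:R : R) / 2 <= ln (m%:R : R) ->
  prime_poor_at (scale k) m -> prime_poor_at (scale k') m' -> (k' <= k)%N.
Proof.
move=> /andP[m'0 m'N] lm [_ mk _] [m'k' _ _]; rewrite leqNgt; apply/negP => kk'.
have lm' : ln (m'%:R : R) <= ln N%:R.
  by rewrite ler_ln ?posrE ?ltr0n ?ler_nat// (leq_trans m'0).
have : (2 + eps) * scale k <= w * scale k'.
  by apply: le_trans (scaleS k) _; rewrite ler_pM2l ?ler_scale.
rewrite (_ : (2 + eps) * _ = scale k + (1 + eps) * scale k); last by ring.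
rewrite -ler_expR expRD.
have : 2 * expR ((1 + eps) * scale k) <= expR (scale k) * expR ((1 + eps) * scale k).
  rewrite ler_pM2r ?expR_gt0//.
  by have := expR_ge1Dx (scale k); have := scale_ge1 k; lra.
lra.
Qed.

Lemma sparse_prime_poor : sparse prime_poor a.
Proof.
apply: (@sparse_of_large _ _ _ (10 * expR 4)); rewrite ?(ltW a0) ?mulr_ge0 ?expR_ge0//.
near=> N; have : 2 <= ln (N%:R : R) by near: N; exact: near_ln_natr_ge.
set l := ln (N%:R : R) => l2.
set X := prime_poor `&` _.
have [[m0 [/andP[m00 m0N] [[k _ km0] /= lm0]]]|none] :=
  pselect (exists m, (0 < m <= N)%N /\ X m); last first.
  have -> : card_upto X N = 0%N.
    apply/eqP; rewrite -leqn0; apply: leq_trans (card_upto_initial 0 N).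
    by apply: leq_card_upto => m mN Xm; case: none; exists m.
  by rewrite !mulr_ge0 ?expR_ge0 ?powR_ge0.
set x := scale k in km0; have x1 : 1 <= x := scale_ge1 k.
have wx0 : 0 <= w * x by rewrite mulr_ge0 ?(ltW w0)//; lra.
have [wxm0 m0x _] := km0.
have wxl : expR (w * x) <= l.
  apply: le_trans (ltW wxm0) _.
  by rewrite ler_ln ?posrE ?ltr0n ?ler_nat// (leq_trans m00).
apply: (@le_trans _ _ (10 * expR 4 * N%:R * expR (- (phi B * (w * x))))).
  apply: le_trans (card_upto_bigomega_le B01 wx0 wxl); rewrite ler_nat.
  apply: leq_card_upto => m mN [[k' _ km] /= lm].
  suff kk' : k' = k by move: km; rewrite kk' => -[].
  apply/eqP; rewrite eqn_leq; apply/andP; split.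
    exact: prime_poor_scale_le mN lm0 km0 km.
  by apply: prime_poor_scale_le lm km km0; rewrite m00.
rewrite -mulrA !ler_wpM2l ?mulr_ge0 ?expR_ge0//.
have l'0 : 0 < l / 2 by lra.
rewrite expRN powRN lef_pV2 ?posrE ?expR_gt0 ?powR_gt0//.
apply: (@le_trans _ _ (expR ((1 + eps) * x) `^ a)).
  by apply: ge0_ler_powR; rewrite ?nnegrE ?expR_ge0 ?(ltW a0) ?(ltW l'0)// (le_trans lm0).
rewrite -expRM ler_expR mulrAC [leRHS]mulrA ler_wpM2r//; lra.
Unshelve. all: by end_near. Qed.

Lemma compl_ll_sieved : compl_ll sieved a.
Proof.
apply: sparse_setC_compl_ll; first by rewrite (ltW a0).
by rewrite setCK; apply: sparseU; [apply: sparse_rough; rewrite a0|exact: sparse_prime_poor].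
Qed.

Lemma notin_prodset_sieved k n : (0 < n)%N ->
  bigomega (loglog_primes (a * (w * scale k))) n = 0%N ->
  (bigomega (loglog_primes (w * scale k)) n)%:R <= 2 * (B * (w * scale k)) ->
  ln (n%:R : R) <= expR ((1 + eps) * scale k) ->
  ~ prodset sieved n.
Proof.
set x := scale k => n0 n_rough n_poor lnn [u Au [v Av uvn]].
have rich z : (0 < z)%N -> sieved z -> (z %| n)%N ->
    B * (w * x) < (bigomega (loglog_primes (w * x)) z)%:R.
  move=> z0 Az zn; rewrite ltNge; apply/negP => z_poor; apply: Az.
  have zn' : ln (z%:R : R) <= ln n%:R.
    by rewrite ler_ln ?posrE ?ltr0n// ler_nat dvdn_leq.
  have lz0 : 0 <= ln (z%:R : R) by rewrite ln_ge0// ler1n.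
  have [lz|lz] := leP (ln (z%:R : R)) (expR (w * x)); [left|right]; last first.
    by exists k => //; split => //; exact: le_trans zn' _.
  move=> p ppr pz; rewrite ltNge; apply/negP => lp.
  have /eqP/(bigomega_eq0P (all_loglog_primes _) n0)/(_ p) := n_rough.
  rewrite (dvdn_trans pz zn) mem_loglog_primes ppr => /(_ _)/negP/=; apply => //.
  apply: le_trans lp _; rewrite mulrC expRM.
  by apply: ge0_ler_powR; rewrite ?nnegrE ?expR_ge0// ltW.
have := n0; rewrite -uvn muln_gt0 => /andP[u0 v0].
have un : (u %| n)%N by rewrite -uvn dvdn_mulr.
have vn : (v %| n)%N by rewrite -uvn dvdn_mull.
have := rich u u0 Au un; have := rich v v0 Av vn.
by move: n_poor; rewrite -uvn bigomegaM// natrD; lra.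
Qed.

End construction.

(** * The complement of the product set *)

Section omega_class_lower_bound.
Context {R : realType}.
Implicit Types (c x y z beta S T : R) (k n : nat).

Lemma ln_fact_le k : ln (k`!%:R : R) <= 1 + (k%:R + 1) * ln k%:R - k%:R.
Proof.
elim: k => [|[|k] IH]; first by rewrite fact0 ln1 ln0//; lra.
  by rewrite factS fact0 ln1; lra.
rewrite factS natrM lnM ?posrE ?ltr0n ?fact_gt0//.
have := ltr0Sn R k; move: IH; rewrite -[k.+2%:R]natr1; move: (ln (k.+1)`!%:R) (k.+1%:R : R).
move=> f x IH x0; have x1 : 0 < x + 1 by lra.
have : ln (x / (x + 1)) <= x / (x + 1) - 1 by rewrite le_ln_sub1 ?divr_gt0.
rewrite ln_div ?posrE// => /(ler_wpM2l (ltW x1)).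
have -> : (x + 1) * (x / (x + 1) - 1) = -1 by field; rewrite gt_eqF.
lra.
Qed.

Lemma mul_ln_sub_le c x S T : 0 <= c -> 0 < T -> 2 * c <= T -> T - c <= S -> 0 <= x <= T ->
  x * (ln T - ln S) <= 2 * c.
Proof.
move=> c0 T0 cT TS /andP[x0 xT]; have S0 : 0 < S by lra.
have : ln T - ln S <= 2 * c / T.
  rewrite -ln_div ?posrE//; apply: le_trans (le_ln_sub1 (divr_gt0 T0 S0)) _.
  rewrite lerBlDr ler_pdivrMr// mulrDl mul1r.
  suff : c <= 2 * c / T * S by lra.
  have -> : 2 * c / T * S = c * (2 * S / T) by ring.
  by rewrite ler_peMr// ler_pdivlMr//; lra.
move=> /(ler_wpM2l x0) /le_trans; apply; rewrite mulrA ler_pdivrMr// mulrC.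
by rewrite ler_wpM2l// mulr_ge0.
Qed.

Lemma pow_fact_ge c beta S T : 0 <= c -> 1 <= T -> 2 * c <= T -> T - c <= S ->
  0 <= beta <= 1 ->
  expR (T * (1 - phi beta) - ln T - (2 * c + 2 - ln beta)) <=
  S ^+ Num.truncn (beta * T) / (Num.truncn (beta * T))`!%:R.
Proof.
move=> c0 T1 cT TS /andP[b0 b1]; have T0 : 0 < T by lra.
have S0 : 0 < S by lra.
have bT0 : 0 <= beta * T by rewrite mulr_ge0// ltW.
set k := Num.truncn _; have kb : k%:R <= beta * T by rewrite truncn_le.
have bk : beta * T < k%:R + 1 by rewrite natr1 truncnS_gt.
have kT : k%:R <= T by apply: le_trans kb _; rewrite ler_piMl// ltW.
rewrite -[leRHS]lnK ?posrE ?divr_gt0 ?exprn_gt0 ?ltr0n ?fact_gt0// ler_expR.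
rewrite ln_div ?posrE ?exprn_gt0 ?ltr0n ?fact_gt0// lnXn// -[leRHS]/(_ - _) -mulr_natl.
have lk : ln (k%:R : R) <= ln T.
  have [->|k0] := posnP k; first by rewrite ln0// ln_ge0.
  by rewrite ler_ln ?posrE ?ltr0n.
have k_lnk : k%:R * ln k%:R <= k%:R * (ln beta + ln T).
  have [->|k0] := posnP k; first by rewrite !mul0r.
  have bp : 0 < beta by rewrite -(pmulr_lgt0 _ T0) (lt_le_trans _ kb)// ltr0n.
  by rewrite ler_wpM2l// -lnM ?posrE// ler_ln ?posrE ?ltr0n ?mulr_gt0.
have k_lnS : k%:R * (ln T - ln S) <= 2 * c by apply: mul_ln_sub_le; rewrite ?ler0n.
have k_ge : (beta * T - 1) * (1 - ln beta) <= k%:R * (1 - ln beta).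
  by have := ln_le0 b1; rewrite -subr_ge0 => ?; rewrite ler_wpM2r//; lra.
have := ln_fact_le k; rewrite phiE; lra.
Qed.

Lemma zeta_ge x : 0 <= x -> expR (x - 1) <= zeta (1 + expR (- x)) :> R.
Proof.
move=> x0; have s1 : 1 < 1 + expR (- x) by rewrite ltrDl expR_gt0.
apply: le_trans (_ : expR x / 2 <= _).
  rewrite expRD ler_pM2l ?expR_gt0// expRN lef_pV2 ?posrE ?expR_gt0//.
  by have := expR_ge1Dx (1 : R); lra.
have := dirichlet_smooth_ge (expR_ge1 x0); rewrite -expRN => /le_trans; apply.
apply: ler_dirichlet => // [||n _]; last by rewrite lern1 leq_b1.
  exact/dirichlet_cvg_unit/unit_valued_bool.
exact: dirichlet_cvg_zeta.
Qed.

Definition loglog_primes_between y z := [seq p <- loglog_primes z | p \notin loglog_primes y].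

Lemma loglog_primes_split y z : y <= z ->
  perm_eq (loglog_primes y ++ loglog_primes_between y z) (loglog_primes z).
Proof.
move=> yz; have sub : {subset loglog_primes y <= loglog_primes z}.
  move=> p; rewrite !mem_loglog_primes => /andP[-> py]/=.
  by apply: le_trans py _; rewrite ler_expR.
apply: uniq_perm; rewrite ?loglog_primes_uniq//.
  rewrite cat_uniq loglog_primes_uniq filter_uniq ?loglog_primes_uniq// andbT/=.
  by apply/hasPn => p; rewrite mem_filter => /andP[].
move=> p; rewrite mem_cat [X in _ || X]mem_filter.
by case: (boolP (p \in loglog_primes y)) => //= /sub ->.
Qed.

Lemma sum_loglog_primes_between_ge y z s : 0 <= y <= z -> 1 <= s <= 1 + expR (- z) ->
  z - y - 9 <= \sum_(p <- loglog_primes_between y z) p%:R `^ (- s).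
Proof.
move=> /andP[y0 yz] /andP[s1 sz]; have := @sum_loglog_primes_ge R z s (le_trans y0 yz).
rewrite s1 sz => /(_ isT); rewrite -(perm_big _ (loglog_primes_split yz)) big_cat/=.
have := sum_loglog_primes_le y0 s1; lra.
Qed.

Lemma dirichlet_omega_class_loglog_ge beta x y z : 0 <= y <= z -> z <= x ->
  18 <= z - y -> 0 <= beta <= 1 ->
  expR (x - z + (z - y) * (1 - phi beta) - ln (z - y) - (29 - ln beta)) <=
  dirichlet (1 + expR (- x)) (fun n => (omega_class (loglog_primes y) (loglog_primes z)
    (Num.truncn (beta * (z - y))) n)%:R).
Proof.
move=> /andP[y0 yz] zx yz18 beta01; set s := 1 + expR (- x); set k := Num.truncn _.
have s1 : 1 < s by rewrite ltrDl expR_gt0.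
have z0 := le_trans y0 yz; have x0 := le_trans z0 zx.
have sz : 1 <= s <= 1 + expR (- z) by rewrite ltW//= lerD2l ler_expR lerN2.
have split_yz := loglog_primes_split yz.
have := @dirichlet_omega_class_ge R s s1 (loglog_primes y) (loglog_primes_between y z) k.
rewrite (perm_all _ split_yz) (perm_uniq split_yz) (perm_big _ split_yz)/=.
move=> /(_ (all_loglog_primes z) (loglog_primes_uniq z)).
rewrite (funext (perm_omega_class k split_yz)).
apply: le_trans.
have := @pow_fact_ge 9 beta _ (z - y) _ _ _ (sum_loglog_primes_between_ge _ sz) beta01.
rewrite y0 yz -/k => /(_ ltac:(lra) ltac:(lra) ltac:(lra) isT) pow_ge.
have prod_ge : expR (- z - 8) <= \prod_(p <- loglog_primes z) (1 - p%:R `^ (- s)).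
  apply: le_trans (prod_euler_factors_ge _ (ltW s1)); rewrite ler_expR.
  by have := sum_loglog_primes_le z0 (ltW s1); rewrite /loglog_primes; lra.
apply: le_trans (ler_pM _ _ pow_ge (ler_pM _ _ (zeta_ge x0) prod_ge)).
- by rewrite -!expRD ler_expR; lra.
- exact: expR_ge0.
- by rewrite mulr_ge0 ?expR_ge0.
- exact: expR_ge0.
- exact: expR_ge0.
Qed.

End omega_class_lower_bound.

Section sparse_upper_bound.
Context {R : realType}.
Implicit Types (b c eps s x y L T C : R) (P : set nat) (f : nat -> R) (n N : nat).

Lemma sum_inv_abel P N : \sum_(1 <= n < N.+1) `[< P n >]%:R / n%:R =
  (card_upto P N)%:R / N.+1%:R +
  \sum_(1 <= n < N.+1) (card_upto P n)%:R / (n%:R * n.+1%:R) :> R.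
Proof.
elim: N => [|N IH]; first by rewrite /card_upto !big_geq// mul0r addr0.
rewrite big_nat_recr//= IH [in RHS]big_nat_recr//=.
have -> : card_upto P N.+1 = (card_upto P N + `[< P N.+1 >])%N.
  by rewrite /card_upto big_nat_recr.
rewrite natrD -[N.+2%:R]natr1.
have := ltr0Sn R N; move: (N.+1%:R : R) => x x0.
by field; rewrite !gt_eqF//; lra.
Qed.

Lemma ln_natrS_sub_ge n : (0 < n)%N -> n.+1%:R^-1 <= ln n.+1%:R - ln n%:R :> R.
Proof.
move=> n0; have := @le_ln_sub1 R (n%:R / n.+1%:R).
rewrite divr_gt0 ?ltr0n// ln_div ?posrE ?ltr0n// => /(_ isT).
have -> : n%:R / n.+1%:R = 1 - n.+1%:R^-1 :> R.
  by rewrite -[n%:R](addrK 1) natr1 mulrBl divff ?mul1r// pnatr_eq0.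
by move: (_^-1) (ln _) (ln _) => i x y; lra.
Qed.

Lemma sum_card_upto_le P b C N0 N : 0 < b < 1 -> 0 <= C -> (0 < N0 <= N)%N ->
  (forall n, (N0 <= n)%N -> (card_upto P n)%:R <= C * (n%:R * ln n%:R `^ (- b))) ->
  \sum_(N0.+1 <= n < N.+1) (card_upto P n)%:R / (n%:R * n.+1%:R) <=
  C / (1 - b) * ln N%:R `^ (1 - b).
Proof.
move=> b01 C0 /andP[N00 N0N] P_le; have /andP[_ b1] := b01.
have b'0 : 0 < 1 - b by rewrite subr_gt0.
rewrite big_add1/=; apply: le_trans (_ : \sum_(N0 <= n < N)
    (C / (1 - b) * ln n.+1%:R `^ (1 - b) - C / (1 - b) * ln n%:R `^ (1 - b)) <= _).
  apply: ler_sum_nat => n /andP[N0n _]; have n0 : (0 < n)%N by exact: leq_trans N0n.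
  have ln0 : 0 <= ln (n%:R : R) by rewrite ln_ge0// ler1n.
  have lnS0 : 0 < ln (n.+1%:R : R) by rewrite ln_gt0// ltr1n.
  apply: le_trans (_ : C * (n.+1%:R^-1 * ln n.+1%:R `^ (- b)) <= _).
    rewrite invfM mulrA ler_pdivrMr ?ltr0n// ler_pdivrMr ?ltr0n//.
    apply: le_trans (P_le _ (leqW N0n)) _.
    rewrite -!mulrA ler_wpM2l// mulrC [leRHS]mulrCA ler_wpM2l ?powR_ge0//.
    by rewrite mulrA ler_peMl ?ler0n// mulrC ler_pdivlMr ?ltr0n// mul1r ler_nat.
  rewrite -mulrBr -mulrA ler_wpM2l// ler_pdivlMl//.
  apply: le_trans (powR1B_sub_ge_tangent b01 ln0 lnS0).
  by rewrite -mulrA ler_pM2l// ler_wpM2r ?powR_ge0// ln_natrS_sub_ge.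
by rewrite telescope_sumr// gerBl mulr_ge0 ?powR_ge0// divr_ge0// ltW.
Qed.

Lemma sparse_sum_inv_le P b : 0 < b < 1 -> sparse P b -> exists2 C : R, 0 <= C &
  \forall N \near \oo, \sum_(1 <= n < N.+1) `[< P n >]%:R / n%:R <= C * ln N%:R `^ (1 - b).
Proof.
move=> b01 [C C0 [N1 _ P_le]]; have /andP[_ b1] := b01.
pose term n : R := (card_upto P n)%:R / (n%:R * n.+1%:R).
have term0 n : 0 <= term n by rewrite divr_ge0.
pose N0 := N1.+1; pose head := \sum_(1 <= n < N0.+1) term n.
have C'0 : 0 <= C / (1 - b) by rewrite divr_ge0// subr_ge0 ltW.
have head0 : 0 <= head by exact: sumr_ge0.
exists (1 + head + C / (1 - b)); first by rewrite !addr_ge0.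
near=> N; have N0N : (N0 <= N)%N by near: N; exact: nbhs_infty_ge.
have l1 : 1 <= ln (N%:R : R) by near: N; exact: near_ln_natr_ge.
have pow1 : 1 <= ln (N%:R : R) `^ (1 - b).
  by rewrite -[leLHS](powRr0 (ln N%:R)) ler_powR// subr_ge0 ltW.
rewrite sum_inv_abel (big_cat_nat _ (n := N0.+1))//= -/head.
have tail : \sum_(N0.+1 <= n < N.+1) term n <= C / (1 - b) * ln N%:R `^ (1 - b).
  by apply: (sum_card_upto_le b01 C0); rewrite ?N0N// => n N0n; apply: P_le; exact: ltnW.
rewrite !mulrDl mul1r -addrA lerD ?lerD ?ler_peMr//; apply: le_trans pow1.
by rewrite ler_pdivrMr ?ltr0n// mul1r ler_nat leqW// card_upto_le.
Unshelve. all: by end_near. Qed.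

Lemma zeta_tail_le L T N : 0 < L ->
  \sum_((floor_expR T).+1 <= n < N.+1) n%:R `^ (- (1 + L^-1)) <=
  (1 + 2 * L) * expR (- (T / (2 * L))).
Proof.
move=> L0; have d0 : 0 < (2 * L)^-1 by rewrite invr_gt0 mulr_gt0.
have s1 : 1 < 1 + (2 * L)^-1 by rewrite ltrDl.
apply: (@le_trans _ _ (\sum_((floor_expR T).+1 <= n < N.+1)
    n%:R `^ (- (1 + (2 * L)^-1)) * expR (- (T / (2 * L))))).
  apply: ler_sum_nat => n /andP[Tn _]; have n0 : (0 < n)%N by exact: leq_ltn_trans Tn.
  rewrite !natr_powRN1D// -mulrA ler_wpM2l ?invr_ge0// -expRD ler_expR.
  have -> : - (L^-1 * ln n%:R) = - ((2 * L)^-1 * ln n%:R) - ln n%:R / (2 * L).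
    by field; rewrite gt_eqF.
  by rewrite lerD2l lerN2 ler_pM2r// ltW// floor_expR_lt_ln.
rewrite -mulr_suml ler_wpM2r ?expR_ge0//.
apply: le_trans (le_trans (sum_natr_powRN_le N s1) _); last first.
  by rewrite addrAC subrr add0r invrK.
have [TN|NT] := leqP (floor_expR T) N; last first.
  rewrite big_geq; last exact: leqW.
  by apply: sumr_ge0 => n _; exact: powR_ge0.
by rewrite [leRHS](big_cat_nat _ (n := (floor_expR T).+1))//= lerDr sumr_ge0// => n _;
  exact: powR_ge0.
Qed.

Lemma dirichlet_head_tail_le s f N C : 1 < s -> unit_valued f ->
  (forall M, \sum_(N.+1 <= n < M.+1) n%:R `^ (- s) <= C) ->
  dirichlet s f <= \sum_(1 <= n < N.+1) f n * n%:R `^ (- s) + C.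
Proof.
move=> s1 f01 tail; apply: dirichlet_le => // M.
have term0 n : 0 <= f n * n%:R `^ (- s).
  by have /andP[fn0 _] := f01 n; rewrite mulr_ge0 ?powR_ge0.
have {}tail : \sum_(N.+1 <= n < M.+1) f n * n%:R `^ (- s) <= C.
  apply: le_trans (tail M); apply: ler_sum => n _.
  by have /andP[_ fn1] := f01 n; rewrite ler_piMl ?powR_ge0.
have [NM|MN] := leqP N M.
  by rewrite (big_cat_nat _ (n := N.+1))//= lerD2l.
rewrite [in leRHS](big_cat_nat _ (n := M.+1)) ?ltnS ?(ltnW MN)//= -addrA lerDl.
rewrite addr_ge0 ?sumr_ge0//; apply: le_trans tail; exact: sumr_ge0.
Qed.

Lemma sub_expR_half_le c x : 0 < c -> 0 <= x -> x - expR (c * x) / 2 <= (c ^+ 2)^-1.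
Proof.
move=> c0 x0; have cx : 0 <= c * x by rewrite mulr_ge0// ltW.
have : (c * x) ^+ 2 / 2 <= expR (c * x).
  by have := expR_ge1Dxn 1 cx; rewrite (_ : 2`! = 2)%N//; lra.
suff : x - (c * x) ^+ 2 / 4 <= (c ^+ 2)^-1 by lra.
rewrite -subr_ge0.
have -> : (c ^+ 2)^-1 - (x - (c * x) ^+ 2 / 4) = (c^-1 - c * x / 2) ^+ 2.
  by field; rewrite gt_eqF.
exact: sqr_ge0.
Qed.

Lemma zeta_tail_bounded eps x N : 0 < eps -> 0 <= x ->
  \sum_((floor_expR (expR ((1 + eps) * x))).+1 <= n < N.+1) n%:R `^ (- (1 + expR (- x))) <=
  3 * expR (eps ^+ 2)^-1.
Proof.
move=> eps0 x0; have e1 := expR_ge1 x0.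
rewrite expRN; apply: le_trans (zeta_tail_le _ _ (expR_gt0 x)) _.
have -> : expR ((1 + eps) * x) / (2 * expR x) = expR (eps * x) / 2.
  by rewrite mulrDl mul1r expRD; field; rewrite gt_eqF// expR_gt0.
apply: (@le_trans _ _ (3 * expR x * expR (- (expR (eps * x) / 2)))).
  by rewrite ler_wpM2r ?expR_ge0//; lra.
by rewrite -mulrA ler_wpM2l// -expRD ler_expR sub_expR_half_le.
Qed.

Lemma sparse_dirichlet_le P b eps : 0 < b < 1 -> 0 < eps -> sparse P b ->
  exists2 C : R, 0 < C & \forall x \near +oo, forall f : nat -> R,
    unit_valued f ->
    (forall n, (0 < n)%N -> ln n%:R <= expR ((1 + eps) * x) -> f n <= `[< P n >]%:R) ->
    dirichlet (1 + expR (- x)) f <= C * expR ((1 + eps) * x * (1 - b)).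
Proof.
move=> b01 eps0 /(sparse_sum_inv_le b01)[C C0 [N0 _ sum_le]]; have /andP[_ b1] := b01.
exists (C + 3 * expR (eps ^+ 2)^-1); first by rewrite ltr_wpDl// mulr_gt0 ?expR_gt0.
near=> x => f f01 fP; have x0 : 0 <= x by near: x; exact: nbhs_pinfty_ge.
have xN0 : ln (N0.+1%:R : R) <= x.
  by near: x; apply: nbhs_pinfty_ge; exact: num_real.
have s1 : 1 < 1 + expR (- x) by rewrite ltrDl expR_gt0.
have X0 : 0 <= (1 + eps) * x by rewrite mulr_ge0// addr_ge0// ltW.
set T := expR _ in fP; set N := floor_expR T.
have xT : x <= T.
  apply: (@le_trans _ _ ((1 + eps) * x)).
    by rewrite ler_peMl// lerDl ltW.
  by have := expR_ge1Dx ((1 + eps) * x); rewrite -/T; lra.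
have N0N : (N0 <= N)%N by apply: ltnW; rewrite leq_floor_expR// (le_trans xN0).
apply: le_trans (dirichlet_head_tail_le s1 f01 (fun M => zeta_tail_bounded M eps0 x0)) _.
rewrite -/T -/N [leRHS]mulrDl; apply: lerD; last first.
  by rewrite ler_peMr ?mulr_ge0 ?expR_ge0// expR_ge1// mulr_ge0// subr_ge0 ltW.
apply: le_trans (_ : C * ln N%:R `^ (1 - b) <= _); last first.
  rewrite ler_wpM2l// expRM; apply: ge0_ler_powR; rewrite ?nnegrE ?expR_ge0 ?subr_ge0 ?(ltW b1)//.
    by rewrite ln_ge0// ler1n floor_expR_gt0// expR_ge0.
  by rewrite ln_floor_expR_le// expR_ge0.
apply: le_trans (sum_le _ N0N); apply: ler_sum_nat => n /andP[n0 nN].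
have /andP[fn0 _] := f01 n; apply: ler_pM => //.
  by rewrite fP// -leq_floor_expR.
by rewrite natr_powRN_le_inv// ltW.
Unshelve. all: by end_near. Qed.

End sparse_upper_bound.

Section psi_upper_bound.
Context {R : realType}.
Implicit Types (a b c w eps x y B C : R) (A : set nat) (k n : nat).

Lemma near_ln_lt_linear c C : 0 < c -> \forall x \near +oo, C + ln x < c * x.
Proof.
move=> c0; have c20 : 0 < c / 2 by rewrite divr_gt0.
near=> x; have x0 : 0 < x by near: x; exact: nbhs_pinfty_gt.
have : (C - ln (c / 2)) / (c / 2) < x.
  by near: x; apply: nbhs_pinfty_gt; exact: num_real.
rewrite ltr_pdivrMr//; have := ln_sublinear (mulr_gt0 c20 x0).
rewrite (lnM c20 x0); lra.
Unshelve. all: by end_near. Qed.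

Definition capped_double B : R := Num.min 1 (2 * B).

Lemma capped_double_itv B : 0 <= B -> 0 <= capped_double B <= 1.
Proof. by move=> B0; rewrite ge_min lexx le_min ler01 mulr_ge0. Qed.

Lemma capped_double_le B : capped_double B <= 2 * B.
Proof. by rewrite ge_min lexx orbT. Qed.

Lemma dirichlet_poor_rough_ge a w B x : 0 <= a <= 1 -> 0 <= w <= 1 -> 0 <= B -> 0 <= x ->
  18 <= (1 - a) * (w * x) ->
  expR ((1 - w * (a + (1 - a) * phi (capped_double B))) * x - ln x -
    (29 - ln (capped_double B))) <=
  dirichlet (1 + expR (- x)) (fun n =>
    (omega_class (loglog_primes (a * (w * x))) (loglog_primes (w * x))
      (Num.truncn (capped_double B * ((1 - a) * (w * x)))) n)%:R).
Proof.
move=> /andP[a0 a1] /andP[w0 w1] B0 x0 T18; have wx0 : 0 <= w * x by rewrite mulr_ge0.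
have TE : (1 - a) * (w * x) = w * x - a * (w * x) by rewrite mulrBl mul1r.
have yz : 0 <= a * (w * x) <= w * x by rewrite mulr_ge0// ler_piMl.
have wx : w * x <= x by rewrite ler_piMl.
rewrite TE; rewrite TE in T18.
apply: le_trans (dirichlet_omega_class_loglog_ge yz wx T18 (capped_double_itv B0)).
rewrite ler_expR; have : ln (w * x - a * (w * x)) <= ln x.
  by have /andP[y0 _] := yz; rewrite ler_ln ?posrE; lra.
lra.
Qed.

Lemma prodset_sieved_dirichlet_ge a w eps B (scale : nat -> R) k C :
  0 < a < 1 -> 0 <= w <= 1 -> 0 <= B -> 0 <= scale k ->
  18 <= (1 - a) * (w * scale k) ->
  (forall f : nat -> R, unit_valued f ->
    (forall n, (0 < n)%N -> ln n%:R <= expR ((1 + eps) * scale k) ->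
      f n <= `[< ~ prodset (sieved a w eps B scale) n >]%:R) ->
    dirichlet (1 + expR (- scale k)) f <= C) ->
  expR ((1 - w * (a + (1 - a) * phi (capped_double B))) * scale k - ln (scale k) -
    (29 - ln (capped_double B))) <= C.
Proof.
move=> /andP[a0 a1] /andP[w0 w1] B0; set x := scale k => x0 T18 upper.
have wx0 : 0 <= w * x by rewrite mulr_ge0.
have := @dirichlet_poor_rough_ge a w B x.
rewrite (ltW a0) (ltW a1) w0 w1 => /(_ isT isT B0 x0 T18) /le_trans; apply.
set m := Num.truncn _; have m_le : m%:R <= 2 * (B * (w * x)).
  have /andP[b0 _] := capped_double_itv B0.
  apply: (@le_trans _ _ (capped_double B * ((1 - a) * (w * x)))).
    by rewrite truncn_le mulr_ge0//; lra.
  rewrite mulrA; apply: ler_pM; rewrite ?capped_double_le//; first by lra.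
  by rewrite ler_piMl//; lra.
apply: upper => [|n n0 lnn]; first exact: unit_valued_bool.
rewrite /omega_class; case: andP => [[/eqP n_rough /eqP n_poor]|_]; last exact: ler0n.
rewrite asboolT//; apply: (@notin_prodset_sieved R a w eps B scale a0 k) => //.
by rewrite n_poor.
Qed.

Lemma prodset_sieved_not_ll a w eps B b (scale : nat -> R) :
  0 < a < 1 -> 0 < w <= 1 -> 0 < eps -> 0 <= B -> 0 < b < 1 ->
  scale k @[k --> \oo] --> +oo ->
  (1 + eps) * (1 - b) < 1 - w * (a + (1 - a) * phi (capped_double B)) ->
  ~ compl_ll (prodset (sieved a w eps B scale)) b.
Proof.
move=> a01 /andP[w0 w1] eps0 B0 b01 scale_cvg gap.
move=> /compl_ll_sparse_setC /(sparse_dirichlet_le b01 eps0)[C C0 upper].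
set kappa := 1 - w * _ in gap; rewrite -subr_gt0 in gap.
near \oo => k.
have x0 : 0 <= scale k by near: k; exact: cvgry_ge.
have T18 : 18 <= (1 - a) * (w * scale k).
  have /andP[_ a1] := a01; rewrite mulrA mulrC -ler_pdivrMr ?mulr_gt0 ?subr_gt0//.
  by near: k; exact: cvgry_ge.
have : expR (kappa * scale k - ln (scale k) - (29 - ln (capped_double B))) <=
    C * expR ((1 + eps) * scale k * (1 - b)).
  apply: (prodset_sieved_dirichlet_ge a01 _ B0 x0 T18); first by rewrite ltW.
  by near: k; exact: scale_cvg upper.
rewrite -[X in _ <= X * _](lnK C0) -expRD ler_expR; apply/negP; rewrite -ltNge.
suff : 29 - ln (capped_double B) + ln C + ln (scale k) < (kappa - (1 + eps) * (1 - b)) * scale k.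
  lra.
by near: k; exact: scale_cvg (near_ln_lt_linear _ gap).
Unshelve. all: by end_near. Qed.

Lemma compl_ll_le A b c : c <= b -> compl_ll A b -> compl_ll A c.
Proof.
move=> cb [C A_ll]; exists `|C|; near=> x.
have xe : expR 1 <= x by near: x; exact: nbhs_pinfty_ge.
have lx : 1 <= ln x.
  by rewrite -[leLHS]expRK ler_ln ?posrE ?expR_gt0// (lt_le_trans (expR_gt0 1)).
apply: (@le_trans _ _ (C * ln x `^ (- b))); first by near: x.
apply: (@le_trans _ _ (`|C| * ln x `^ (- b))).
  by rewrite ler_wpM2r ?powR_ge0// ler_norm.
by rewrite ler_wpM2l// ler_powR// lerN2.
Unshelve. all: by end_near. Qed.

Lemma cvg_geometric_pinfty x : 1 < x -> x ^+ k @[k --> \oo] --> +oo.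
Proof.
move=> x1; have x'0 : 0 < x - 1 by rewrite subr_gt0.
have linear_le k : k%:R * (x - 1) <= x ^+ k.
  elim: k => [|k IH]; first by rewrite mul0r.
  by have := exprn_ege1 k (ltW x1); rewrite exprS -natr1; nra.
apply/cvgryPge => y; near=> k; apply: le_trans (linear_le k).
by rewrite -ler_pdivrMr//; near: k; exact: nbhs_infty_ger.
Unshelve. all: by end_near. Qed.

Lemma phi_itv x : 0 <= x <= 1 -> 0 <= phi x <= 1.
Proof.
move=> x01; have [phi_itv01 _ _] := @phi_bij R.
by have := phi_itv01 x; rewrite /= !in_itv/=; apply.
Qed.

Lemma le_phi_inv B y : 0 <= B <= 1 -> 0 <= y <= 1 -> (B <= phi_inv y) = (y <= phi B).
Proof.
move=> B01 y01; have yI : y \in `[0, 1] by rewrite in_itv.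
by rewrite -{2}(phi_invK yI) (le_nmono_in (@phi_decr R)) ?phi_inv_itv// in_itv.
Qed.

(* The limit, as [w] decreases to [a / phi B], of the decay exponent of the integers missing from
   [prodset (sieved a w eps B scale)]. *)
Definition sieve_exponent a B : R :=
  a / phi B * (a + (1 - a) * phi (capped_double B)).

Lemma sieve_exponent_bounds a B : 0 < a < 1 -> 0 <= B -> 4 * a <= phi B ->
  0 < sieve_exponent a B <= 1 / 4.
Proof.
move=> /andP[a0 a1] B0 aB; have f0 : 0 < phi B by lra.
have /andP[g0 g1] := phi_itv (capped_double_itv B0).
have u0 : 0 < a / phi B by rewrite divr_gt0.
have u4 : a / phi B <= 1 / 4 by rewrite ler_pdivrMr//; lra.
rewrite /sieve_exponent; move: (a / _) (phi (capped_double B)) u0 u4 g0 g1 => u g u0 u4 g0 g1.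
have c0 : 0 < a + (1 - a) * g by nra.
have c1 : a + (1 - a) * g <= 1 by nra.
by rewrite mulr_gt0//=; nra.
Qed.

Lemma sieve_exponent_le_W a B : 0 < a < 1 -> 0 <= B -> 4 * a <= phi B ->
  sieve_exponent a B <= W a B.
Proof.
move=> /andP[a0 _] B0 aB; have f0 : 0 < phi B by lra.
have /andP[g0 _] := phi_itv (capped_double_itv B0).
rewrite /sieve_exponent /W -/(capped_double B).
move: (phi B) (phi (capped_double B)) f0 aB g0 => f g f0 fa g0.
set q := Num.sqrt _.
have qle : q <= f - 2 * a.
  have -> : f - 2 * a = Num.sqrt ((f - 2 * a) ^+ 2).
    by rewrite sqrtr_sqr ger0_norm//; lra.
  rewrite /q; apply: ler_wsqrtr; rewrite -subr_ge0.
  by rewrite (_ : _ - _ = (2 * a) ^+ 2) ?sqr_ge0//; ring.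
have aq : a * (a / f) <= (f - q) ^+ 2 / (4 * f).
  rewrite ler_pdivlMr ?mulr_gt0//.
  have -> : a * (a / f) * (4 * f) = (2 * a) ^+ 2 by field; rewrite gt_eqF.
  by rewrite ler_sqr ?nnegrE; lra.
have := mulr_ge0 (mulr_ge0 (ltW a0) (divr_ge0 (ltW a0) (ltW f0))) g0.
move: aq; rewrite mulrA [a * (g / f)]mulrCA mulrA [g * a / f]mulrAC; lra.
Qed.

Lemma exists_prodset_not_ll a B b : 0 < a < 1 -> 0 <= B <= 1 -> 4 * a <= phi B ->
  sieve_exponent a B < b < 1 ->
  exists2 A : set nat, compl_ll A a & ~ compl_ll (prodset A) b.
Proof.
move=> a01 /andP[B0 B1] aB /andP[cb b1]; have /andP[a0 a1] := a01.
have f0 : 0 < phi B by lra.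
have /andP[c0 c4] := sieve_exponent_bounds a01 B0 aB.
have u0 : 0 < a / phi B by rewrite divr_gt0.
have u4 : a / phi B <= 1 / 4 by rewrite ler_pdivrMr//; lra.
pose eps := b - sieve_exponent a B; have eps0 : 0 < eps by rewrite subr_gt0.
pose w := (1 + eps) * (a / phi B).
have w0 : 0 < w by rewrite mulr_gt0// addr_gt0.
have w1 : w <= 1 by rewrite /w /eps; nra.
pose scale k := ((2 + eps) / w) ^+ k.
have ratio1 : 1 < (2 + eps) / w by rewrite ltr_pdivlMr// mul1r; lra.
exists (sieved a w eps B scale).
  apply: compl_ll_sieved; rewrite ?B0 ?(ltW a1)//.
  - by rewrite /w mulrCA [phi B * _]mulrC divfK ?gt_eqF.
  - by move=> k; exact: exprn_ege1 (ltW ratio1).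
  - by move=> k; rewrite /scale exprS mulrA [w * _]mulrC divfK ?gt_eqF.
apply: prodset_sieved_not_ll; rewrite ?w0 ?b1 ?andbT//.
- exact: lt_trans cb.
- exact: cvg_geometric_pinfty.
have -> : w * (a + (1 - a) * phi (capped_double B)) = (1 + eps) * sieve_exponent a B.
  by rewrite /w /sieve_exponent; ring.
rewrite -subr_gt0 (_ : _ - _ = eps ^+ 2) ?exprn_gt0//.
by rewrite /eps; ring.
Qed.

Lemma psi_le_W a B : 0 < a < 1 / 4 -> B \in `[0, phi_inv (4 * a)] ->
  (psi a <= (W a B)%:E)%E.
Proof.
move=> /andP[a0 a4] BI; have a01 : 0 < a < 1 by rewrite a0; lra.
have I4a : 4 * a \in `[0, 1] by rewrite in_itv/=; lra.
have := phi_inv_itv I4a; move: BI; rewrite !in_itv/= => /andP[B0 Binv] /andP[_ inv1].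
have B01 : 0 <= B <= 1 by rewrite B0 (le_trans Binv).
have aB : 4 * a <= phi B by rewrite -le_phi_inv// ?B01//; lra.
apply: ge_ereal_sup => _ [b [_ b_ll] <-]; rewrite lee_fin leNgt; apply/negP => Wb.
have cb := le_lt_trans (sieve_exponent_le_W a01 B0 aB) Wb.
have /andP[_ c4] := sieve_exponent_bounds a01 B0 aB.
have [|A A_ll []] := @exists_prodset_not_ll a B (Num.min b (1 / 2)) a01 B01 aB.
  by rewrite lt_min gt_min cb; lra.
by apply: compl_ll_le (b_ll A A_ll); rewrite ge_min lexx.
Qed.

End psi_upper_bound.

(** * The size of [K a] *)

Section exponential_bounds.
Context {R : realType}.
Implicit Types (x y z : R) (n : nat).

Lemma sum_exp_coeff_le_expR x n : 0 <= x -> \sum_(0 <= k < n) x ^+ k / k`!%:R <= expR x.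
Proof.
move=> x0; apply: (@nondecreasing_cvgn_le R (series (exp_coeff x))).
  by apply: nondecreasing_series => k _ _; rewrite /exp_coeff/= mulr_ge0 ?exprn_ge0.
exact: is_cvg_series_exp_coeff.
Qed.

(* The remainder is dominated by a geometric series of ratio 1 / 2. *)
Lemma expR_le_sum_exp_coeff x n : 0 <= x <= 1 / 2 ->
  expR x <= \sum_(0 <= k < n) x ^+ k / k`!%:R + 2 * (x ^+ n / n`!%:R).
Proof.
move=> /andP[x0 x1]; set c := x ^+ n / _; set P := \sum_(0 <= k < n) _.
have c0 : 0 <= c by rewrite divr_ge0 ?exprn_ge0.
have term m : x ^+ (n + m) / (n + m)`!%:R <= c * 2^-1 ^+ m.
  rewrite exprD /c -mulrA [leRHS]mulrAC -[leRHS]mulrA ler_wpM2l ?exprn_ge0//.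
  apply: ler_pM; rewrite ?exprn_ge0 ?invr_ge0//.
    by rewrite lerXn2r ?nnegrE//; lra.
  by rewrite lef_pV2 ?posrE ?ltr0n ?fact_gt0// ler_nat leq_fact// leq_addr.
have partial m : \sum_(0 <= k < n + m) x ^+ k / k`!%:R <= P + (2 - 2 * 2^-1 ^+ m) * c.
  elim: m => [|m IH]; first by rewrite addn0 expr0 -/P; lra.
  rewrite addnS big_nat_recr//=; apply: le_trans (lerD IH (term m)) _.
  by rewrite exprS; move: (_ ^+ m) => z; lra.
apply: limr_le; first exact: is_cvg_series_exp_coeff.
near=> N; have nN : (n <= N)%N by near: N; exact: nbhs_infty_ge.
apply: (@le_trans _ _ (\sum_(0 <= k < N) x ^+ k / k`!%:R)); first by [].
rewrite -(subnKC nN); apply: le_trans (partial _) _.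
rewrite lerD2l ler_wpM2r// gerBl mulr_ge0// exprn_ge0// invr_ge0//.
Unshelve. all: by end_near. Qed.

Let factE := (fact0, factS 0, factS 1, factS 2, factS 3, factS 4).

Lemma natr_mul_le_ln n x y z : 0 < z -> expR x <= y -> y ^+ n <= z -> n%:R * x <= ln z.
Proof.
move=> z0 xy yz; rewrite -ler_expR lnK ?posrE// expRM_natl; apply: le_trans yz.
by rewrite lerXn2r ?nnegrE ?expR_ge0// (le_trans (expR_ge0 x)).
Qed.

Lemma ln_le_natr_mul n x y z : 0 < z -> 0 <= y <= expR x -> z <= y ^+ n -> ln z <= n%:R * x.
Proof.
move=> z0 /andP[y0 yx] zy; rewrite -ler_expR lnK ?posrE// expRM_natl; apply: le_trans zy _.
by rewrite lerXn2r ?nnegrE ?expR_ge0.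
Qed.

(* [exp (24 / 277) <= 494 / 453 < 2 `^ (1 / 8) < 1735 / 1591 <= exp (375 / 4328)] *)
Lemma ln2_bounds : 192 / 277 <= ln (2 : R) <= 375 / 541.
Proof.
have exp_le : expR (24 / 277 : R) <= 494 / 453.
  apply: le_trans (@expR_le_sum_exp_coeff _ 5 _) _; first by lra.
  by rewrite !big_nat_recr//= big_geq// !factE; lra.
have exp_ge : 1735 / 1591 <= expR (375 / 4328 : R).
  apply: le_trans (@sum_exp_coeff_le_expR _ 5 _); last by lra.
  by rewrite !big_nat_recr//= big_geq// !factE; lra.
have : (8%:R * (24 / 277) : R) <= ln 2.
  by apply: natr_mul_le_ln exp_le _; lra.
have : ln 2 <= (8%:R * (375 / 4328) : R).
  by apply: (@ln_le_natr_mul _ _ (1735 / 1591)); [|apply/andP; split|]; lra.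
lra.
Qed.

Lemma ln_40_39_bounds : 2 / 79 <= ln (40 / 39 : R) <= 7 / 276.
Proof.
have exp_le : expR (2 / 79 : R) <= 40 / 39.
  apply: le_trans (@expR_le_sum_exp_coeff _ 4 _) _; first by lra.
  by rewrite !big_nat_recr//= big_geq// !factE; lra.
have exp_ge : 40 / 39 <= expR (7 / 276 : R).
  apply: le_trans (@sum_exp_coeff_le_expR _ 3 _); last by lra.
  by rewrite !big_nat_recr//= big_geq// !factE; lra.
by rewrite -[X in X <= _ <= _]expRK -[X in _ <= _ <= X]expRK !ler_ln ?posrE ?expR_gt0// exp_le.
Qed.

End exponential_bounds.

Section K_bounds.
Context {R : realType}.
Implicit Types (a B : R).

Lemma K_le_W a B : 0 < a < 1 / 4 -> 0 <= B <= 1 -> 4 * a <= phi B -> K a <= W a B.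
Proof.
move=> a14 B01 aB; have [_ Kmin] := K_min a14; apply: Kmin.
have /andP[B0 _] := B01; rewrite in_itv/= B0 le_phi_inv//.
by have /andP[_ ?] := phi_itv B01; lra.
Qed.

Lemma W_lt a B : 0 < a -> 0 < phi B ->
  a * (2 * phi B - phi (capped_double B)) ^+ 2 <
    phi B ^+ 2 * (phi B - phi (capped_double B)) ->
  W a B < a.
Proof.
rewrite /W -/(capped_double B); move: (phi _) (phi (capped_double _)) => f g a0 f0 gap.
set q := Num.sqrt _; set y := f ^+ 2 - 4 * a * f + 2 * a * g.
have y_sqr : y ^+ 2 < f ^+ 2 * (f ^+ 2 - 4 * a * f).
  rewrite -subr_gt0 (_ : _ - _ =
    4 * a * (f ^+ 2 * (f - g) - a * (2 * f - g) ^+ 2)); last by rewrite /y; ring.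
  by rewrite mulr_gt0 ?subr_gt0// mulr_gt0.
have disc_gt0 : 0 < f ^+ 2 - 4 * a * f.
  by rewrite -(pmulr_rgt0 _ (exprn_gt0 2 f0)) (le_lt_trans (sqr_ge0 y)).
have y_lt : y < f * q.
  apply: le_lt_trans (ler_norm _) _; rewrite -sqrtr_sqr.
  have -> : f * q = Num.sqrt (f ^+ 2 * (f ^+ 2 - 4 * a * f)).
    by rewrite sqrtrM ?sqr_ge0// sqrtr_sqr gtr0_norm.
  by rewrite ltr_sqrt// mulr_gt0 ?exprn_gt0.
rewrite -(ltr_pM2r (_ : 0 < 4 * f)) ?mulr_gt0//.
have -> : ((f - q) ^+ 2 / (4 * f) + a * (g / f)) * (4 * f) =
    f ^+ 2 - 2 * (f * q) + q ^+ 2 + 4 * a * g by field; rewrite gt_eqF.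
by move: y_lt; rewrite sqr_sqrtr ?ltW// /y; lra.
Qed.

(* [39 / 320] nearly maximizes the bound on [a] given by [W_lt]: the maximum, about 0.117176, is
   reached near 0.12175. *)
Lemma phi_39_320_bounds (B := 39 / 320 : R) :
  [/\ 1 - B - B * (7 / 276 + 3 * (375 / 541)) <= phi B,
      0 <= 2 * phi B - phi (capped_double B) <= 1 - 2 * B * (192 / 277)
    & B * (1 + 192 / 277 + 2 / 79) <= phi B - phi (capped_double B)].
Proof.
have [/andP[ln2_ge ln2_le] /andP[c_ge c_le]] := (@ln2_bounds R, @ln_40_39_bounds R).
have B0 : 0 < B by rewrite /B; lra.
have lnB : ln B = - ln (40 / 39) - 3 * ln 2.
  have -> : B = (40 / 39 * 2 ^+ 3)^-1 by rewrite /B; field.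
  by rewrite lnV ?lnM ?posrE ?lnXn//; lra.
have -> : capped_double B = 2 * B by rewrite /capped_double min_r// /B; lra.
rewrite !phiE lnM ?posrE// lnB /B; split; [lra|apply/andP; split; lra|lra].
Qed.

Lemma K_lt a : 0 < a <= (11 * 10 ^+ 3 + 717) / 10 ^+ 5 -> K a < a.
Proof.
move=> /andP[a0 a1]; pose B : R := 39 / 320.
have [phi_ge /andP[sum_ge0 sum_le] diff_ge] := phi_39_320_bounds.
have phi_ge' : 62 / 100 <= phi B by apply: le_trans phi_ge; lra.
have a14 : 0 < a < 1 / 4 by apply/andP; split; lra.
have B01 : 0 <= B <= 1 by rewrite /B; apply/andP; split; lra.
have phi4a : 4 * a <= phi B by apply: le_trans phi_ge'; lra.
apply: le_lt_trans (K_le_W a14 B01 phi4a) _; apply: W_lt => //.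
  by apply: lt_le_trans phi_ge'; lra.
apply: le_lt_trans (_ : (11 * 10 ^+ 3 + 717) / 10 ^+ 5 *
  (1 - 2 * (39 / 320) * (192 / 277)) ^+ 2 < _).
  by apply: ler_pM; rewrite ?sqr_ge0 ?(ltW a0)// lerXn2r// nnegrE (le_trans sum_ge0).
set X := 1 - _ - _ in phi_ge; have X0 : 0 <= X by rewrite /X; lra.
apply: (@lt_le_trans _ _ (X ^+ 2 * (39 / 320 * (1 + 192 / 277 + 2 / 79)))).
  by rewrite /X; lra.
apply: (ler_pM _ _ _ diff_ge); [exact: sqr_ge0|lra|].
by rewrite ler_sqr ?nnegrE; [exact: phi_ge|exact: X0|exact: le_trans X0 phi_ge].
Qed.

Lemma phi_half : phi (1 / 2 : R) = (1 - ln 2) / 2.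
Proof. by rewrite phiE div1r lnV ?posrE//; lra. Qed.

Lemma phi_half_gt0 : 0 < phi (1 / 2 : R).
Proof. by rewrite phi_half; have /andP[_] := @ln2_bounds R; lra. Qed.

Lemma W_half_le a : 0 < a -> 4 * a <= phi (1 / 2 : R) ->
  W a (1 / 2) <= a ^+ 2 / phi (1 / 2) + 12 / phi (1 / 2) ^+ 2 * a ^+ 3.
Proof.
rewrite /W (_ : 2 * (1 / 2) = 1 :> R); last by lra.
rewrite minxx phi1 mul0r mulr0 addr0; move: (phi _) => f a0 fa.
have f0 : 0 < f by lra.
set q := Num.sqrt _.
have [r [r0 r4 aE]] : exists r, [/\ 0 < r, r <= 1 / 4 & a = r * f].
  by exists (a / f); rewrite divr_gt0// divfK ?gt_eqF// ler_pdivrMr//; split => //; lra.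
have r_sqr : r * r <= r * (1 / 4) by rewrite ler_pM2l.
have q_ge : f - 2 * a * (1 + 4 * r) <= q.
  apply: le_trans (ler_norm _) _; rewrite -sqrtr_sqr; apply: ler_wsqrtr.
  rewrite -subr_ge0 aE (_ : _ - _ = 4 * (r * f) ^+ 2 * (3 - 8 * r - 16 * r ^+ 2)).
    by rewrite mulr_ge0 ?mulr_ge0 ?sqr_ge0//; lra.
  by ring.
have q_le : q <= f.
  rewrite -[leRHS]ger0_norm ?(ltW f0)// -sqrtr_sqr; apply: ler_wsqrtr.
  by rewrite gerBl !mulr_ge0// ltW.
apply: (@le_trans _ _ ((2 * a * (1 + 4 * r)) ^+ 2 / (4 * f))).
  rewrite ler_pM2r ?invr_gt0 ?mulr_gt0// lerXn2r ?nnegrE ?subr_ge0//; last by lra.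
  by rewrite !mulr_ge0 ?(ltW a0)//; lra.
rewrite -subr_ge0 aE (_ : _ - _ = 4 * f * r ^+ 3 * (1 - 4 * r)).
  by rewrite !mulr_ge0 ?exprn_ge0 ?(ltW f0) ?(ltW r0)//; lra.
by field; rewrite gt_eqF.
Qed.

Lemma K_asymptotic : exists2 h : R -> R,
    h a / a ^+ 2 @[a --> 0^'+] --> 0
  & \forall a \near 0^'+, K a <= 2 * a ^+ 2 / (1 - ln 2) + h a.
Proof.
have f0 := phi_half_gt0.
exists (fun a => 12 / phi (1 / 2) ^+ 2 * a ^+ 3).
  have lim : 12 / phi (1 / 2 : R) ^+ 2 * a @[a --> 0^'+] --> (0 : R).
    rewrite -[X in _ --> X](mulr0 (12 / phi (1 / 2 : R) ^+ 2)).
    apply: cvgM; first exact: cvg_cst.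
    by apply: cvg_at_right_filter; exact: cvg_id.
  apply: cvg_trans lim; apply: near_eq_cvg; near=> a.
  have a0 : 0 < a by near: a; exact: nbhs_right_gt.
  by field; rewrite !gt_eqF.
near=> a.
have a0 : 0 < a by near: a; exact: nbhs_right_gt.
have aphi : a < phi (1 / 2) / 4.
  by near: a; apply: nbhs_right_lt; rewrite divr_gt0.
have half01 : 0 <= (1 / 2 : R) <= 1 by lra.
have /andP[_ phi_le1] := phi_itv half01.
have phi4a : 4 * a <= phi (1 / 2 : R) by lra.
apply: le_trans (K_le_W _ half01 phi4a) _; first by rewrite a0; lra.
apply: le_trans (W_half_le a0 phi4a) _.
rewrite lerD2r phi_half le_eqVlt; apply/predU1P; left; field.
by have := f0; rewrite phi_half; lra.
Unshelve. all: by end_near. Qed.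

End K_bounds.

Theorem theorem1p1 (R : realType) :
  [/\ forall a : R, 0 < a < 1 / 4 -> (psi a <= (K a)%:E)%E,
      forall a : R, 0 < a <= (11 * 10 ^+ 3 + 717) / 10 ^+ 5 -> K a < a
    & exists2 h : R -> R,
        h a / a ^+ 2 @[a --> 0^'+] --> 0
      & \forall a \near 0^'+,
          K a <= 2 * a ^+ 2 / (1 - ln 2) + h a].
Proof.
split; [|exact: K_lt|exact: K_asymptotic].
by move=> a a14; have [[B BI ->] _] := K_min a14; exact: psi_le_W.
Qed.
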